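(* Let $n\ge4$ be an integer and assume that $\mathcal H_{F,r^2}(n)$ is semisimple (equivalently $r^{2k}\neq 1$ for all integers $1\le k\le n$). Suppose $l=-r^3$. When $n=4$, the irreducible $3$-dimensional invariant subspace of $\mathcal V^{(4)}$ is spanned by the vectors $$u_1=r\,w_{23}+w_{13}+\big(\tfrac1r+\tfrac1{r^3}\big)w_{34}-w_{24}-\tfrac1r w_{14},$$ $$u_2=-r\,w_{12}-r^2\,w_{13}-\tfrac1r w_{34}-\tfrac1{r^2}w_{24}+\big(r+\tfrac1r\big)w_{14},$$ $$u_3=(r+r^3)\,w_{12}+\tfrac1r w_{23}-w_{13}+w_{24}-r\,w_{14}.$$ When $n\ge5$, the irreducible $\frac{(n-1)(n-2)}{2}$-dimensional invariant subspace of $\mathcal V^{(n)}$ is the direct sum of the irreducible $\frac{(n-2)(n-3)}{2}$-dimensional invariant subspace of $\mathcal V^{(n-1)}$ and of the span of the $n-2$ linearly independent vectors $$V_k^{(n)}=w_{k+1,n}-r\,w_{k,n}+r^{n-k}\,w_{k,k+1},\qquad k=1,\dots,n-2 .$$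
   Context: Let $l,r$ be nonzero complex numbers with $r^2\ne1$, $m=\frac1r-r$ and $F=\mathbb{Q}(l,r)\subseteq\mathbb{C}$. The Lawrence--Krammer space $\mathcal V^{(n)}$ is the $F$-vector space with basis $(w_{s,t})_{1\le s<t\le n}$ (also written $w_{st}$); $\mathcal V^{(n-1)}$ is viewed inside $\mathcal V^{(n)}$ as the span of the $w_{s,t}$ with $t\le n-1$. For $1\le i\le n-1$ the generator $g_i$ acts on $\mathcal V^{(n)}$ by the endomorphism $\nu_i$ defined by: - $\nu_i(w_{i,i+1})=\frac1l w_{i,i+1}$; - $\nu_i(w_{s,i})=w_{s,i+1}$ for $s\le i-1$; - $\nu_i(w_{i+1,k})=w_{i,k}+m\,r^{k-i-2}\,w_{i,i+1}-m\,w_{i+1,k}$ for $k\ge i+2$; - $\nu_i(w_{s,i+1})=w_{s,i}+\frac{m}{l\,r^{i-s-1}}\,w_{i,i+1}-m\,w_{s,i+1}$ for $s\le i-1$; - $\nu_i(w_{i,k})=w_{i+1,k}$ for $k\ge i+2$; - $\nu_i(w_{s,k})=r\,w_{s,k}$ in all remaining cases ($\{s,k\}\cap\{i,i+1\}=\emptyset$). An invariant subspace of $\mathcal V^{(n)}$ is a subspace stable under all $\nu_i$, $1\le i\le n-1$; irreducible means nonzero with no invariant subspaces other than $0$ and itself. When $l=-r^3$, $n\ge4$ and the semisimplicity assumption holds, $\mathcal V^{(n)}$ has exactly one irreducible invariant subspace of dimension $\frac{(n-1)(n-2)}{2}$; this is the subspace referred to in the claim (and likewise for $n-1$). $\mathcal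 H_{F,r^2}(n)$ is the Iwahori--Hecke algebra of $Sym(n)$ with parameter $r^2$ over $F$, generated (after rescaling) by $g_1,\dots,g_{n-1}$ with the braid relations and $g_i^2+m\,g_i=1$. *)

(* Defs.v *)
From HB Require Import structures.
From mathcomp Require Import all_boot all_order all_algebra.
From mathcomp Require Import boolp.

Set Implicit Arguments.
Unset Strict Implicit.
Unset Printing Implicit Defensive.

Import GRing.Theory.
Local Open Scope ring_scope.

Section GeneratedSubfield.
Variables (C : fieldType) (a b : C).

(* The intersection of all subfields of C containing a and b; for C of
   characteristic 0 this is Q(a,b). *)
Definition gen_subfield : {pred C} := fun x =>
  `[< forall S : {pred C}, GRing.divring_closed S ->
        a \in S -> b \in S -> x \in S >].

Lemma gen_subfieldP (x : C) :
  reflect (forall S : {pred C}, GRing.divring_closed S ->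
             a \in S -> b \in S -> x \in S) (x \in gen_subfield).
Proof. exact: asboolP. Qed.

Lemma gen_subfield_closed : GRing.divring_closed gen_subfield.
Proof.
split=> [|x y /gen_subfieldP Fx /gen_subfieldP Fy
         |x y /gen_subfieldP Fx /gen_subfieldP Fy];
  apply/gen_subfieldP => S clS Sa Sb; have [S1 SB SV] := clS => //.
- by apply: SB; [apply: Fx | apply: Fy].
- by apply: SV; [apply: Fx | apply: Fy].
Qed.

HB.instance Definition _ :=
  GRing.isDivringClosed.Build C gen_subfield gen_subfield_closed.

Record genF := GenF { genF_val : C; _ : genF_val \in gen_subfield }.

HB.instance Definition _ := [isSub for genF_val].
HB.instance Definition _ := [Choice of genF by <:].
HB.instance Definition _ := [SubChoice_isSubComUnitRing of genF by <:].
HB.instance Definition _ := [SubComUnitRing_isSubIntegralDomain of genF by <:].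
HB.instance Definition _ := [SubIntegralDomain_isSubField of genF by <:].

Lemma gen_subfield1 : a \in gen_subfield.
Proof. exact/gen_subfieldP. Qed.

Lemma gen_subfield2 : b \in gen_subfield.
Proof. exact/gen_subfieldP. Qed.

Definition genF1 : genF := GenF gen_subfield1.
Definition genF2 : genF := GenF gen_subfield2.

End GeneratedSubfield.

Section InvariantSubspaces.
Variables (F : fieldType) (E : vectType F).

(* Only the operators g 1, ..., g (n - 1) of the family are relevant. *)
Definition invariant (n : nat) (g : nat -> 'End(E)) (W : {vspace E}) : Prop :=
  forall i : nat, (0 < i < n)%N -> (g i @: W <= W)%VS.

Definition irreducible_invariant (n : nat) (g : nat -> 'End(E))
    (W : {vspace E}) : Prop :=
  [/\ invariant n g W, W <> 0%VS
    & forall X : {vspace E}, invariant n g X -> (X <= W)%VS ->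
        X = 0%VS \/ X = W].

End InvariantSubspaces.

Section HeckeAlgebra.
Variables (F : fieldType) (r : F).

Definition lk_m : F := r^-1 - r.

(* The structure of a module over the Iwahori-Hecke algebra H_{F,r^2}(n) on E,
   H_{F,r^2}(n) being given by its presentation. *)
Definition hecke_module (n : nat) (E : vectType F) (g : nat -> 'End(E)) :
    Prop :=
  [/\ forall i : nat, (0 < i < n)%N ->
        (g i \o g i + lk_m *: g i = \1)%VF,
      forall i : nat, (0 < i)%N -> (i.+1 < n)%N ->
        (g i \o (g i.+1 \o g i) = g i.+1 \o (g i \o g i.+1))%VF
    & forall i j : nat, (0 < i)%N -> (i.+1 < j)%N -> (j < n)%N ->
        (g i \o g j = g j \o g i)%VF].

(* The algebra is finite-dimensional, so it is semisimple iff all its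
   finite-dimensional modules are semisimple, i.e. iff in each of them every
   submodule has a complementary submodule. *)
Definition hecke_semisimple (n : nat) : Prop :=
  forall (E : vectType F) (g : nat -> 'End(E)), hecke_module n g ->
  forall U : {vspace E}, invariant n g U ->
  exists U' : {vspace E},
    [/\ invariant n g U', (U + U' = fullv)%VS & (U :&: U' = 0)%VS].

End HeckeAlgebra.

Section LawrenceKrammer.
Variables (F : fieldType) (l r : F).

(* The pairs (s, t) with 1 <= s < t <= n. *)
Definition lk_index (n : nat) : finType :=
  {p : 'I_n.+1 * 'I_n.+1 | (0 < p.1 < p.2)%N}.

Definition lk (n : nat) : vectType F := {ffun lk_index n -> F^o}.

(* The basis vector w_{s,t}; it is 0 (junk) unless 1 <= s < t <= n. *)
Definition lk_w (n s t : nat) : lk n :=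
  [ffun p : lk_index n =>
     (((val p).1 == s :> nat) && ((val p).2 == t :> nat))%:R : F^o].

(* The linear map that sends w_{s,t} to f s t, for 1 <= s < t <= n. *)
Definition lk_ext (n : nat) (E : vectType F) (f : nat -> nat -> E) :
    'Hom(lk n, E) :=
  linfun (fun v : {ffun lk_index n -> F^o} =>
    \sum_(p : lk_index n) (v p : F) *: f (val p).1 (val p).2).

Lemma lk_extE (n : nat) (E : vectType F) (f : nat -> nat -> E) (s t : nat) :
  (0 < s)%N -> (s < t)%N -> (t <= n)%N -> lk_ext n f (lk_w n s t) = f s t.
Proof.
move=> s0 st tn; rewrite /lk_ext.
pose h (v : {ffun lk_index n -> F^o}) :=
  \sum_(p : lk_index n) (v p : F) *: f (val p).1 (val p).2.
have hlin : linear h.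
  move=> c u v; rewrite /h scaler_sumr -big_split /=; apply: eq_bigr => p _.
  by rewrite !ffunE scalerDl scalerA.
pose hL := GRing.isLinear.Build _ _ _ _ h hlin.
pose H : {linear {ffun lk_index n -> F^o} -> E} := HB.pack h hL.
rewrite (lfunE H) /= /h.
have sn : (s < n.+1)%N by apply: leq_trans (ltnW st) _.
pose P (p : 'I_n.+1 * 'I_n.+1) := (0 < p.1 < p.2)%N.
pose q0 : 'I_n.+1 * 'I_n.+1 := (Ordinal sn, Ordinal (tn : (t < n.+1)%N)).
have hp : P q0 by rewrite /P /= s0.
rewrite (bigD1 (exist P q0 hp : lk_index n)) //= ffunE /= !eqxx scale1r.
rewrite big1 ?addr0 // => -[[x y] /= q] neq; rewrite ffunE /=.
case: eqP => [xs|_]; last by rewrite scale0r.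
case: eqP => [yt|_]; last by rewrite scale0r.
by case/eqP: neq; apply: val_inj; congr pair; apply: val_inj.
Qed.

Definition lk_nu_basis (n i s t : nat) : lk n :=
  let w := lk_w n in let m := lk_m r in
  if (s == i) && (t == i.+1) then l^-1 *: w i i.+1
  else if t == i then w s i.+1
  else if s == i.+1 then
    w i t + (m * r ^+ (t - i - 2)) *: w i i.+1 - m *: w i.+1 t
  else if t == i.+1 then
    w s i + (m / (l * r ^+ (i - s - 1))) *: w i i.+1 - m *: w s i.+1
  else if s == i then w i.+1 t
  else r *: w s t.

Definition lk_nu (n i : nat) : 'End(lk n) := lk_ext n (lk_nu_basis n i).

(* The inclusion of V^(n') into V^(n), for n' <= n. *)
Definition lk_incl (n' n : nat) : 'Hom(lk n', lk n) := lk_ext n' (lk_w n).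

Definition lk_main_subspace (n : nat) (W : {vspace lk n}) : Prop :=
  irreducible_invariant n (lk_nu n) W /\
  \dim W = (((n - 1) * (n - 2)) %/ 2)%N.

Definition lk_u1 (n : nat) : lk n :=
  let w := lk_w n in
  r *: w 2 3 + w 1 3 + (r^-1 + (r ^+ 3)^-1) *: w 3 4 - w 2 4 - r^-1 *: w 1 4.

Definition lk_u2 (n : nat) : lk n :=
  let w := lk_w n in
  - r *: w 1 2 - r ^+ 2 *: w 1 3 - r^-1 *: w 3 4 - (r ^+ 2)^-1 *: w 2 4
  + (r + r^-1) *: w 1 4.

Definition lk_u3 (n : nat) : lk n :=
  let w := lk_w n in
  (r + r ^+ 3) *: w 1 2 + r^-1 *: w 2 3 - w 1 3 + w 2 4 - r *: w 1 4.

Definition lk_V (n k : nat) : lk n :=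
  let w := lk_w n in
  w k.+1 n - r *: w k n + r ^+ (n - k) *: w k k.+1.

Definition lk_Vs (n : nat) : seq (lk n) := [seq lk_V n k | k <- iota 1 (n - 2)].

End LawrenceKrammer.

(* Main.v *)
From HB Require Import structures.
Require Import Defs.
From mathcomp Require Import all_boot all_order all_algebra.
From mathcomp Require Import reals complex.
From mathcomp Require boolp.
From mathcomp Require Import zify ring.

(** The vectors V_k^(t) with k + 2 <= t <= n span an invariant subspace W_n, and
    W_n is the direct sum of W_(n-1) and of the span of the V_k^(n).

    Let X be an invariant subspace of W_n. If g_1, hence every g_i, acts on X by
    the scalar r, then the coordinates x_(s,t) of x in X are r^(s-1) x_(1,t), and
    a linear functional that kills W_n gives x_(1,2) = 0, whence X = 0. Otherwise
    the image of X under r - g_1 contains a nonzero combination of the V_1^(t).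
    Applying the r - g_i to it produces V_1^(3), up to the factors [2] and [n],
    and V_1^(3) generates W_n.

    If another invariant subspace of the same dimension existed, it would meet W_n
    trivially, which forces n = 4 and V^(4) = X + W_4. As g_1^2 + m g_1 - 1 maps
    V^(n) onto the line of w_12, this line would then lie in X or in W_4, but w_12
    generates V^(n).

    The semisimplicity assumption enters through [n][n-1] <> 0: this is the squared
    norm of the q-symmetric vector in the permutation module on ordered pairs of
    distinct elements, and the line of that vector has no invariant complement if
    its norm is 0. *)

Set Implicit Arguments.
Unset Strict Implicit.
Unset Printing Implicit Defensive.

Import GRing.Theory.
Local Open Scope ring_scope.

(** * Coordinates *)

Section Coordinates.
Variables (F : fieldType) (n : nat).

Lemma lk_hom_ext (E : vectType F) (f : nat -> nat -> E) (x : lk F n) :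
  lk_ext n f x = \sum_(p : lk_index n) (x p : F) *: f (val p).1 (val p).2.
Proof.
pose h (v : {ffun lk_index n -> F^o}) :=
  \sum_(p : lk_index n) (v p : F) *: f (val p).1 (val p).2.
have hlin : linear h.
  move=> c u v; rewrite /h scaler_sumr -big_split /=; apply: eq_bigr => p _.
  by rewrite !ffunE scalerDl scalerA.
pose H : {linear {ffun lk_index n -> F^o} -> E} :=
  HB.pack h (GRing.isLinear.Build _ _ _ _ h hlin).
exact: (lfunE H).
Qed.

Lemma lk_decomp_index (x : lk F n) :
  x = \sum_(p : lk_index n) (x p : F) *: lk_w F n (val p).1 (val p).2.
Proof.
apply/ffunP => q; rewrite sum_ffunE (bigD1 q) //= !ffunE !eqxx /=.
rewrite big1 ?addr0; first by rewrite /GRing.scale /= mulr1.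
move=> p neq; rewrite !ffunE /=.
case: eqP => [/val_inj e1|_]; last by rewrite scaler0.
case: eqP => [/val_inj e2|_]; last by rewrite scaler0.
case/eqP: neq; apply: val_inj.
by rewrite [LHS]surjective_pairing [RHS]surjective_pairing e1 e2.
Qed.

Lemma lk_index_bounds (p : lk_index n) :
  [/\ (0 < (val p).1)%N, ((val p).1 < (val p).2)%N & ((val p).2 <= n)%N].
Proof.
by case: p => -[a b] /= /andP[h1 h2]; split=> //; rewrite -ltnS.
Qed.

Lemma lk_hom_eq (E : vectType F) (f g : 'Hom(lk F n, E)) (x : lk F n) :
  (forall s t, (0 < s)%N -> (s < t)%N -> (t <= n)%N ->
     f (lk_w F n s t) = g (lk_w F n s t)) -> f x = g x.
Proof.
move=> fg; rewrite (lk_decomp_index x) !linear_sum; apply: eq_bigr => p _.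
by have [? ? ?] := lk_index_bounds p; rewrite !linearZ /= fg.
Qed.

(** Being linear and indexed by naturals, coordinates can be compared on basis vectors by
    [lk_hom_eq]; indices out of range give 0. *)
Definition lk_co (s t : nat) : 'Hom(lk F n, F^o) :=
  lk_ext n (fun s' t' => ((s' == s) && (t' == t))%:R : F^o).

Lemma lk_co_w s t s' t' : (0 < s')%N -> (s' < t')%N -> (t' <= n)%N ->
  lk_co s t (lk_w F n s' t') = ((s' == s) && (t' == t))%:R.
Proof. exact: lk_extE. Qed.

Definition lk_list : seq (lk F n) :=
  [seq lk_w F n s t | t <- iota 1 n, s <- iota 1 (t - 1)].

Lemma mem_lk_list s t : (0 < s)%N -> (s < t)%N -> (t <= n)%N ->
  lk_w F n s t \in lk_list.
Proof.
move=> s0 st tn; apply/allpairsPdep; exists t, s.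
by rewrite !mem_iota; split=> //; lia.
Qed.

Lemma lk_subv (X : {vspace lk F n}) :
  (forall s t, (0 < s)%N -> (s < t)%N -> (t <= n)%N -> lk_w F n s t \in X) ->
  X = fullv.
Proof.
move=> wX; apply/eqP; rewrite eqEsubv subvf /=; apply/subvP => x _.
rewrite (lk_decomp_index x); apply: memv_suml => p _; apply: memvZ.
by have [? ? ?] := lk_index_bounds p; apply: wX.
Qed.

Lemma size_lk_list : (size lk_list * 2 = n * (n - 1))%N.
Proof.
rewrite size_allpairs_dep.
under eq_map do rewrite size_iota.
elim: n => // k IH.
rewrite -[in iota _ _](addn1 k) iotaD map_cat sumn_cat /= mulnDl IH; nia.
Qed.

(** [lk_list] spans. The bound limits the size of [X + W] in the uniqueness proof. *)
Lemma dim_lk_le : (\dim {:lk F n} * 2 <= n * (n - 1))%N.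
Proof.
rewrite -size_lk_list leq_mul2r /=.
rewrite -(@lk_subv <<lk_list>>%VS) ?dim_span // => s t s0 st tn.
by apply: memv_span; apply: mem_lk_list.
Qed.

Lemma lk_decomp (x : lk F n) :
  x = \sum_(1 <= t < n.+1) \sum_(1 <= s < t) lk_co s t x *: lk_w F n s t.
Proof.
rewrite [LHS](_ : _ = \1%VF x); last by rewrite lfunE.
pose H := (\sum_(1 <= t < n.+1) \sum_(1 <= s < t)
   lk_ext n (fun s' t' => ((s' == s) && (t' == t))%:R *: lk_w F n s t))%VF.
have HE y : H y = \sum_(1 <= t < n.+1) \sum_(1 <= s < t)
   lk_co s t y *: lk_w F n s t.
  rewrite sum_lfunE; apply: eq_bigr => t _; rewrite sum_lfunE.
  apply: eq_bigr => s _; rewrite !lk_hom_ext scaler_suml; apply: eq_bigr => p _.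
  by rewrite scalerA.
rewrite -HE; apply: lk_hom_eq => s t s0 st tn; rewrite lfunE HE /=.
rewrite (bigD1_seq t) ?iota_uniq ?mem_index_iota //=; last by lia.
rewrite (bigD1_seq s) ?iota_uniq ?mem_index_iota //=; last by lia.
rewrite lk_co_w // !eqxx scale1r !big1 ?addr0 //.
- move=> t' tt; apply: big1 => s' _.
  by rewrite lk_co_w // [t == _]eq_sym (negbTE tt) andbF scale0r.
- by move=> s' ss; rewrite lk_co_w // [s == _]eq_sym (negbTE ss) scale0r.
Qed.

Lemma lk_co_eq0 (x : lk F n) :
  (forall s t, (0 < s)%N -> (s < t)%N -> (t <= n)%N -> lk_co s t x = 0) -> x = 0.
Proof.
move=> x0; rewrite (lk_decomp x) big_nat big1 // => t tn.
by rewrite big_nat big1 // => s st; rewrite x0 ?scale0r //; lia.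
Qed.

End Coordinates.

(** * The vectors V_k^(t) *)

Section Action.
Variables (F : fieldType) (r : F) (n : nat).

Let l : F := - r ^+ 3.
Let w := lk_w F n.
Let nu := lk_nu l r n.

(* V_k^(t), as a vector of V^(n). *)
Definition lk_vec (k t : nat) : lk F n :=
  lk_w F n k.+1 t - r *: lk_w F n k t + r ^+ (t - k) *: lk_w F n k k.+1.

Lemma lk_nu_w i s t : (0 < s)%N -> (s < t)%N -> (t <= n)%N ->
  nu i (w s t) = lk_nu_basis l r n i s t.
Proof. exact: lk_extE. Qed.

Lemma scale_regularE (a b : F) : a *: (b : F^o) = a * b. Proof. by []. Qed.

Lemma lk_nu_w_diag i : (0 < i)%N -> (i < n)%N ->
  nu i (w i i.+1) = l^-1 *: w i i.+1.
Proof. by move=> *; rewrite lk_nu_w ?ltnS // /lk_nu_basis !eqxx. Qed.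

Ltac nu_basis :=
  rewrite lk_nu_w /lk_nu_basis; try lia;
  by repeat (case: ifP => ?; first [exfalso; lia | idtac]).

Lemma lk_nu_w_si s i : (0 < s)%N -> (s < i)%N -> (i <= n)%N ->
  nu i (w s i) = w s i.+1.
Proof. by move=> *; nu_basis. Qed.

Lemma lk_nu_w_Sik i k : (0 < i)%N -> (i.+1 < k)%N -> (k <= n)%N ->
  nu i (w i.+1 k) =
  w i k + (lk_m r * r ^+ (k - i - 2)) *: w i i.+1 - lk_m r *: w i.+1 k.
Proof. by move=> *; nu_basis. Qed.

Lemma lk_nu_w_sSi s i : (0 < s)%N -> (s < i)%N -> (i < n)%N ->
  nu i (w s i.+1) =
  w s i + (lk_m r / (l * r ^+ (i - s - 1))) *: w i i.+1 - lk_m r *: w s i.+1.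
Proof. by move=> *; nu_basis. Qed.

Lemma lk_nu_w_ik i k : (0 < i)%N -> (i.+1 < k)%N -> (k <= n)%N ->
  nu i (w i k) = w i.+1 k.
Proof. by move=> *; nu_basis. Qed.

Lemma lk_nu_w_far i s t : (0 < s)%N -> (s < t)%N -> (t <= n)%N ->
  s != i -> s != i.+1 -> t != i -> t != i.+1 -> nu i (w s t) = r *: w s t.
Proof. by move=> *; nu_basis. Qed.

Ltac coords :=
  apply/ffunP => ?; rewrite /lk_vec !(ffunE, scale_regularE) /lk_m /l.
(** Exponents become numerals or [d] plus a numeral, so that [field] can treat [r ^+ d] as an
    atom. *)
Ltac expos d :=
  repeat match goal with |- context [(?a - ?b)%N] =>
    first [ rewrite (_ : (a - b)%N = d); [|lia]
          | rewrite (_ : (a - b)%N = d.+1); [|lia]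
          | rewrite (_ : (a - b)%N = d.+2); [|lia]
          | rewrite (_ : (a - b)%N = d.+3); [|lia]
          | rewrite (_ : (a - b)%N = 0%N); [|lia]
          | rewrite (_ : (a - b)%N = 1%N); [|lia]
          | rewrite (_ : (a - b)%N = 2%N); [|lia] ]
  end.

Hypothesis r0 : r != 0.

Ltac solve_nu d :=
  coords; expos d; rewrite ?exprS ?expr0; field;
  by rewrite ?(oppr_eq0, mulf_eq0, expf_eq0, oner_eq0, negbTE r0, andbF).
Ltac nu_lin := rewrite /lk_vec !linearD !linearN !linearZ /= -/w.

(** The value [l = - r ^+ 3] enters here and in [lk_nu_vec_corner]: on [w k k.+1] the contributions
    [m r^(t-k-2)] and [r^(t-k) / l] add up to [- r^(t-k-1)]. *)
Lemma lk_nu_vec_same k t : (0 < k)%N -> (k.+1 < t)%N -> (t <= n)%N ->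
  nu k (lk_vec k t) = - r^-1 *: lk_vec k t.
Proof.
move=> k0 kt tn; have [d td] : exists d, t = (k + d).+2 by exists (t - k - 2)%N; lia.
nu_lin; rewrite lk_nu_w_Sik // lk_nu_w_ik // lk_nu_w_diag; try lia.
by solve_nu d.
Qed.

Lemma lk_nu_vec_corner k : (0 < k)%N -> (k.+2 <= n)%N ->
  nu k.+1 (lk_vec k k.+2) = - r^-1 *: lk_vec k k.+2.
Proof.
move=> k0 kn; nu_lin; rewrite lk_nu_w_diag // lk_nu_w_sSi // lk_nu_w_si; try lia.
by solve_nu 0%N.
Qed.

Lemma lk_nu_vec_up k t : (0 < k)%N -> (k.+2 < t)%N -> (t <= n)%N ->
  nu k.+1 (lk_vec k t) =
  lk_vec k.+1 t + r *: lk_vec k t - r ^+ (t - k - 1) *: lk_vec k k.+2.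
Proof.
move=> k0 kt tn; have [d td] : exists d, t = (k + d).+3 by exists (t - k - 3)%N; lia.
nu_lin; rewrite lk_nu_w_ik; try lia.
rewrite lk_nu_w_far; try lia.
rewrite lk_nu_w_si; try lia.
by solve_nu d.
Qed.

Lemma lk_nu_vec_down k t : (0 < k)%N -> (k.+2 < t)%N -> (t <= n)%N ->
  nu k (lk_vec k.+1 t) =
  r *: lk_vec k.+1 t + lk_vec k t - r ^+ (t - k - 2) *: lk_vec k k.+2.
Proof.
move=> k0 kt tn; have [d td] : exists d, t = (k + d).+3 by exists (t - k - 3)%N; lia.
nu_lin; rewrite lk_nu_w_far; try lia.
rewrite lk_nu_w_Sik; try lia.
rewrite lk_nu_w_Sik; try lia.
by solve_nu d.
Qed.

Lemma lk_nu_vec_top k t : (0 < k)%N -> (k.+1 < t)%N -> (t < n)%N ->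
  nu t (lk_vec k t) = lk_vec k t.+1.
Proof.
move=> k0 kt tn; have [d td] : exists d, t = (k + d).+2 by exists (t - k - 2)%N; lia.
nu_lin; rewrite lk_nu_w_si; try lia.
rewrite lk_nu_w_si; try lia.
rewrite lk_nu_w_far; try lia.
by solve_nu d.
Qed.

(** The two multiples of [w t t.+1] that arise cancel: [m / (l r^(t-k-2)) = r m / (l r^(t-k-1))]. *)
Lemma lk_nu_vec_topS k t : (0 < k)%N -> (k.+1 < t)%N -> (t < n)%N ->
  nu t (lk_vec k t.+1) = lk_vec k t - lk_m r *: lk_vec k t.+1.
Proof.
move=> k0 kt tn; have [d td] : exists d, t = (k + d).+2 by exists (t - k - 2)%N; lia.
nu_lin; rewrite lk_nu_w_sSi; try lia.
rewrite lk_nu_w_sSi; try lia.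
rewrite lk_nu_w_far; try lia.
by solve_nu d.
Qed.

Lemma lk_nu_vec_far i k t : (0 < k)%N -> (k.+1 < t)%N -> (t <= n)%N ->
  i != k -> i != k.+1 -> i.+1 != k -> i != t -> i.+1 != t ->
  nu i (lk_vec k t) = r *: lk_vec k t.
Proof.
move=> k0 kt tn *; have [d td] : exists d, t = (k + d).+2 by exists (t - k - 2)%N; lia.
nu_lin; rewrite lk_nu_w_far; try lia.
rewrite lk_nu_w_far; try lia.
rewrite lk_nu_w_far; try lia.
by solve_nu d.
Qed.
End Action.

(** * The span of the V_k^(t): invariance and generation by V_1^(3) *)

Section MainSubspace.
Variables (F : fieldType) (r : F) (n : nat).

Let nu := lk_nu (- r ^+ 3) r n.
Let V := lk_vec r n.

Definition lk_W : {vspace lk F n} :=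
  <<[seq lk_vec r n k t | t <- iota 3 (n - 2), k <- iota 1 (t - 2)]>>%VS.

Lemma mem_lk_W k t : (0 < k)%N -> (k.+1 < t)%N -> (t <= n)%N -> V k t \in lk_W.
Proof.
move=> k0 kt tn; apply: memv_span; apply/allpairsPdep; exists t, k.
by rewrite !mem_iota; split=> //; lia.
Qed.

Lemma lk_W_sub (X : {vspace lk F n}) :
  (forall k t, (0 < k)%N -> (k.+1 < t)%N -> (t <= n)%N -> V k t \in X) ->
  (lk_W <= X)%VS.
Proof.
move=> VX; apply/span_subvP => _ /allpairsPdep[t [k [tI kI ->]]].
by move: tI kI; rewrite !mem_iota => *; apply: VX; lia.
Qed.

Lemma lk_W_hom (E : vectType F) (f : 'Hom(lk F n, E)) (X : {vspace E}) x :
  (forall k t, (0 < k)%N -> (k.+1 < t)%N -> (t <= n)%N -> f (V k t) \in X) ->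
  x \in lk_W -> f x \in X.
Proof.
move=> fX; have /subvP WX : (lk_W <= f @^-1: X)%VS.
  by apply: lk_W_sub => k t *; rewrite -memv_preim; apply: fX.
by move/WX; rewrite -memv_preim.
Qed.

Lemma inv_mem (E : vectType F) (m : nat) (g : nat -> 'End(E)) (X : {vspace E}) i x :
  Defs.invariant m g X -> (0 < i < m)%N -> x \in X -> g i x \in X.
Proof. by move=> iX im xX; apply: (subvP (iX i im)); apply: memv_img. Qed.

Ltac co_nu :=
  rewrite -[LHS]comp_lfunE ?(=^~ @scale_lfunE); apply: lk_hom_eq => s t s0 st tn;
  rewrite ?scale_lfunE comp_lfunE /nu lk_nu_w // /lk_nu_basis;
  repeat (case: ifP => ?); rewrite ?(linearB, linearD, linearZ) /= !lk_co_w; try lia;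
  repeat match goal with |- context [(?a == ?b)%N] =>
    case: (eqVneq a b) => [?|?]; try (exfalso; lia)
  end; rewrite /= ?scale_regularE ?(oppr0, mulr0, mulr1, addr0, subr0).

(** Among the basis vectors, only [w i.+1 k] has an image under [nu i] that involves [w i k], and
    the coefficient is 1. *)
Lemma lk_co_nu_ik i k x : (0 < i)%N -> (i.+1 < k)%N -> (i < n)%N ->
  lk_co F n i k (nu i x) = lk_co F n i.+1 k x.
Proof. by move=> i0 ik ltin; co_nu. Qed.

Lemma lk_co_nu_1i i x : (1 < i)%N -> (i < n)%N ->
  lk_co F n 1 i (nu i x) = lk_co F n 1 i.+1 x.
Proof. by move=> i0 ltin; co_nu. Qed.

Lemma lk_co_nu_far i k x : (1 < i)%N -> (i.+1 < k)%N -> (i < n)%N ->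
  lk_co F n 1 k (nu i x) = r * lk_co F n 1 k x.
Proof.
by move=> i0 ik ltin; rewrite -[RHS]scale_regularE -[RHS]scale_lfunE; co_nu.
Qed.

Hypothesis r0 : r != 0.

Lemma lk_W_inv : Defs.invariant n nu lk_W.
Proof.
move=> i /andP[i0 lt_in]; apply/subvP => _ /memv_imgP[x xW ->].
apply: lk_W_hom xW => k t k0 kt tn.
have VW a b : (0 < a)%N -> (a.+1 < b)%N -> (b <= n)%N -> lk_vec r n a b \in lk_W.
  exact: mem_lk_W.
have [->|nik] := eqVneq i k; first by rewrite lk_nu_vec_same // memvZ ?VW.
have [eik|nik1] := eqVneq i k.+1.
  subst i; have [ekt|nkt] := eqVneq k.+2 t.
    by subst t; rewrite lk_nu_vec_corner ?memvZ ?VW //; lia.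
  rewrite lk_nu_vec_up; [apply: memvB; first apply: memvD|..]; rewrite ?memvZ ?VW //; lia.
have [eik|nik2] := eqVneq i.+1 k.
  subst k; rewrite lk_nu_vec_down; [apply: memvB; first apply: memvD|..];
    rewrite ?memvZ ?VW //; lia.
have [eit|nit] := eqVneq i t.
  by subst i; rewrite lk_nu_vec_top ?VW //; lia.
have [eit|nit1] := eqVneq i.+1 t.
  subst t; rewrite lk_nu_vec_topS; [apply: memvB|..]; rewrite ?memvZ ?VW //; lia.
by rewrite lk_nu_vec_far ?memvZ ?VW.
Qed.

Lemma lk_vec13_gen (X : {vspace lk F n}) : (3 <= n)%N ->
  Defs.invariant n nu X -> V 1 3 \in X -> (lk_W <= X)%VS.
Proof.
move=> n3 iX v13; apply: lk_W_sub => k t k0; move: t.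
elim: k k0 => // -[_ _|k IH _] t kt tn.
  elim: t kt tn => // t IHt t2 tn; have [<-//|nt] := eqVneq 2%N t.
  rewrite /V -lk_nu_vec_top //; last lia.
  by apply: (inv_mem iX); rewrite ?IHt //; lia.
(* This is [lk_nu_vec_up] solved for its leading term; all other terms have first index [k.+1],
   which the induction covers. *)
have -> : V k.+2 t = nu k.+2 (V k.+1 t) - r *: V k.+1 t
                     + r ^+ (t - k.+1 - 1) *: V k.+1 k.+3.
  by rewrite /V lk_nu_vec_up // (addrAC _ _ (- (r *: _))) addrK subrK.
apply: memvD; [apply: memvB; first apply: (inv_mem iX)|]; rewrite ?memvZ ?IH //; lia.
Qed.

End MainSubspace.

(** * Invariant subspaces on which g_1 acts by the scalar r *)

Section ScalarAction.
Variables (F : fieldType) (r : F) (n : nat).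
Hypothesis r0 : r != 0.

Let nu := lk_nu (- r ^+ 3) r n.
Let W := lk_W r n.

(** The weights kill every V_k^(t). For [t >= 3], those of [w 1 t] and [w 2 t] also cancel on any
    [x] with [x_(2,t) = r x_(1,t)], which isolates [x_(1,2)]. *)
Definition lk_phi : 'Hom(lk F n, F^o) := @lk_ext F n F^o (fun s t =>
  if s == 1%N then if t == 2%N then - (r + r^-1) else - r ^+ (t - 1)
  else if s == 2%N then r ^+ (t - 2) else 0).

Lemma lk_phi_W x : x \in W -> lk_phi x = 0.
Proof.
move=> xW; apply/eqP; rewrite -memv0; apply: (lk_W_hom _ xW) => k t k0 kt tn.
rewrite memv0 /lk_vec linearD linearB !linearZ /= !lk_extE; try lia.
case: k k0 kt => // -[|[|k]] _ kt; rewrite ?scale_regularE /=.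
- have [d ->] : exists d, t = d.+3 by exists (t - 3)%N; lia.
  rewrite !subSS !subn0 /= !exprS; apply/eqP; field; exact: r0.
- by rewrite expr1; apply/eqP; ring.
- by rewrite !(oppr0, mulr0, addr0).
Qed.

Hypothesis q2 : r + r^-1 != 0.

Lemma lk_inv_scalar (X : {vspace lk F n}) : Defs.invariant n nu X ->
  (X <= W)%VS -> (forall x, x \in X -> nu 1 x = r *: x) -> X = 0%VS.
Proof.
move=> iX /subvP XW nu1.
(* Induction on the row: [x_(s+2,t)] is the coordinate [(s+1,t)] of [nu s.+1 x], which reduces to
   row 1, where [nu s.+1] acts by [r]; for [s = 0] this is the hypothesis on [nu 1]. *)
have co_s s x t : x \in X -> (s.+1 < t)%N -> (t <= n)%N ->
    lk_co F n s.+1 t x = r ^+ s * lk_co F n 1 t x.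
  elim: s x => [|s IH] x xX st tn; first by rewrite mul1r.
  rewrite -(@lk_co_nu_ik _ r); try lia.
  have [-> | s0] := eqVneq s 0%N; first by rewrite nu1 // linearZ.
  rewrite IH ?lk_co_nu_far; try lia; first by rewrite mulrA -exprSr.
  by apply: (inv_mem iX) => //; lia.
have co12 x : x \in X -> lk_co F n 1 2 x = 0.
  move=> xX; have := lk_phi_W (XW x xX); rewrite [in lk_phi x](lk_decomp x).
  have [n2|n2] := ltnP n 2.
    move=> _; rewrite lk_hom_ext big1 // => p _; have [] := lk_index_bounds p; lia.
  rewrite linear_sum big_ltn; last lia.
  rewrite (@big_geq _ _ _ 1 1) // linear0 add0r big_ltn; last lia.
  rewrite [X in _ + X]big_nat [X in _ + X]big1 ?addr0.
    rewrite big_nat1 linearZ /= lk_extE //= => /eqP.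
    by rewrite mulf_eq0 oppr_eq0 (negbTE q2) orbF => /eqP.
  move=> t /andP[t2 tn]; rewrite linear_sum big_ltn; last lia.
  rewrite big_ltn; last lia.
  rewrite big_nat big1 ?addr0 => [|s /andP[s2 st]].
    rewrite !linearZ /= !lk_extE /=; try lia.
    rewrite (@co_s 1%N) //; case: ifP => [|_]; first lia.
    have [d ->] : exists d, t = d.+3 by exists (t - 3)%N; lia.
    by rewrite !scale_regularE !subSS !subn0 !exprS; ring.
  by rewrite linearZ /= lk_extE; try lia; do 2?[case: ifP => ?; first lia]; rewrite scaler0.
(* The vanishing spreads along row 1: [x_(1,t+1)] is the coordinate [(1,t)] of [nu t x], which is
   again in [X]. *)
have co1 t x : x \in X -> (1 < t)%N -> (t <= n)%N -> lk_co F n 1 t x = 0.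
  elim: t x => // t IH x xX t1 tn; have [->|t2] := eqVneq t 1%N; first exact: co12.
  rewrite -(@lk_co_nu_1i _ r); try lia.
  by rewrite IH //; try lia; apply: (inv_mem iX) => //; lia.
apply/eqP; rewrite -subv0; apply/subvP => x xX; rewrite memv0; apply/eqP.
apply: lk_co_eq0 => -[//|s] t _ st tn.
by rewrite co_s // co1 ?mulr0 //; lia.
Qed.

End ScalarAction.

(** * Irreducibility *)

Section Hom.
Variables (F : fieldType) (aT rT : vectType F) (f : 'Hom(aT, rT)).

Lemma homB u v : f (u - v) = f u - f v. Proof. exact: linearB. Qed.
Lemma homD u v : f (u + v) = f u + f v. Proof. exact: linearD. Qed.
Lemma homZ a u : f (a *: u) = a *: f u. Proof. exact: linearZ. Qed.
Lemma homN u : f (- u) = - f u. Proof. exact: linearN. Qed.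
Lemma hom0 : f 0 = 0. Proof. exact: linear0. Qed.
Lemma hom_sum (I : Type) (s : seq I) (g : I -> aT) :
  f (\sum_(i <- s) g i) = \sum_(i <- s) f (g i).
Proof. exact: linear_sum. Qed.

End Hom.

(** Reduces vector identities in an abstract space to identities in [F], which [field] can
    decide. *)
Lemma hom_separates (F : fieldType) (U : vectType F) (x y : U) :
  (forall f : 'Hom(U, F^o), f x = f y) -> x = y.
Proof.
move=> fxy; rewrite (coord_vbasis (memvf x)) (coord_vbasis (memvf y)).
apply: eq_bigr => i _; congr (_ *: _).
pose h (u : U) : F^o := coord (vbasis {:U}) i u.
have hlin : linear h by move=> a u v; rewrite /h linearP.
pose H : {linear U -> F^o} := HB.pack h (GRing.isLinear.Build _ _ _ _ h hlin).
by have := fxy (linfun H); rewrite !lfunE.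
Qed.

Lemma span_mapP (F : fieldType) (E : vectType F) (I : eqType) (s : seq I) (f : I -> E) y :
  uniq s -> y \in <<[seq f i | i <- s]>>%VS ->
  exists c : I -> F, y = \sum_(i <- s) c i *: f i.
Proof.
elim: s y => [|i s IH] y /=.
  by rewrite span_nil memv0 => _ /eqP->; exists (fun=> 0); rewrite big_nil.
case/andP=> nis us; rewrite span_cons => /memv_addP[_ /vlineP[a ->] [z zs ->]].
have [c ->] := IH z us zs; exists (fun j => if j == i then a else c j).
rewrite big_cons eqxx; congr (_ + _); apply: eq_big_seq => j js.
by case: eqP => // ji; rewrite -ji js in nis.
Qed.

(** * Extracting V_1^(3) from a combination of the V_1^(t) *)

Section ColumnVectors.
Variables (F : fieldType) (U : vectType F) (r : F) (n : nat).
Variables (nu : nat -> 'End(U)) (V : nat -> nat -> U).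
Hypotheses (r0 : r != 0) (q2 : r + r^-1 != 0).
Hypothesis qn : \sum_(j < n) (r ^+ 2) ^+ j != 0.
Hypothesis n4 : (4 <= n)%N.
Hypothesis nu_same : forall t, (2 < t)%N -> (t <= n)%N ->
  nu 1 (V 1 t) = - r^-1 *: V 1 t.
Hypothesis nu_corner : nu 2 (V 1 3) = - r^-1 *: V 1 3.
Hypothesis nu_up : forall t, (3 < t)%N -> (t <= n)%N ->
  nu 2 (V 1 t) = V 2 t + r *: V 1 t - r ^+ (t - 2) *: V 1 3.
Hypothesis nu_down : forall t, (3 < t)%N -> (t <= n)%N ->
  nu 1 (V 2 t) = r *: V 2 t + V 1 t - r ^+ (t - 3) *: V 1 3.
Hypothesis nu_top : forall t, (2 < t)%N -> (t < n)%N -> nu t (V 1 t) = V 1 t.+1.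
Hypothesis nu_topS : forall t, (2 < t)%N -> (t < n)%N ->
  nu t (V 1 t.+1) = V 1 t - lk_m r *: V 1 t.+1.
Hypothesis nu_far : forall i t, (2 < t)%N -> (t <= n)%N -> (2 < i)%N ->
  i != t -> i.+1 != t -> nu i (V 1 t) = r *: V 1 t.

Let E i : 'End(U) := (r *: \1 - nu i)%VF.

Let EE i x : E i x = r *: x - nu i x.
Proof. by rewrite /E add_lfunE opp_lfunE scale_lfunE id_lfunE. Qed.

Ltac vring := apply: hom_separates => ?; rewrite !(homB, homD, homZ, homN, hom0) /lk_m;
  rewrite !scale_regularE.

Let E1_V1 t : (2 < t)%N -> (t <= n)%N -> E 1 (V 1 t) = (r + r^-1) *: V 1 t.
Proof. by move=> *; rewrite EE nu_same // scaleNr opprK -scalerDl. Qed.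

Let E1_V2 t : (3 < t)%N -> (t <= n)%N ->
  E 1 (V 2 t) = r ^+ (t - 3) *: V 1 3 - V 1 t.
Proof.
move=> t3 tn; rewrite EE nu_down //.
by rewrite -addrA opprD addNKr opprB.
Qed.

Let E2_V13 : E 2 (V 1 3) = (r + r^-1) *: V 1 3.
Proof. by rewrite EE nu_corner ?scaleNr ?opprK -?scalerDl //; lia. Qed.

Let E2_V1 t : (3 < t)%N -> (t <= n)%N ->
  E 2 (V 1 t) = r ^+ (t - 2) *: V 1 3 - V 2 t.
Proof.
move=> t3 tn; rewrite EE nu_up //.
by rewrite (addrC (V 2 t)) -addrA opprD addNKr opprB.
Qed.

Let d i := r *: V 1 i - V 1 i.+1.

(** [E i] kills [V 1 t] unless [t] is [i] or [i.+1]; these two go to [d i] and [- r^-1 *: d i]. *)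
Let E_sum (c : nat -> F) i : (2 < i)%N -> (i < n)%N ->
  E i (\sum_(3 <= t < n.+1) c t *: V 1 t) = (c i - c i.+1 / r) *: d i.
Proof.
move=> i2 ltin; rewrite hom_sum /=.
rewrite (bigD1_seq i) ?iota_uniq ?mem_index_iota //=; last lia.
rewrite -big_filter (bigD1_seq i.+1) ?filter_uniq ?iota_uniq //=; last first.
  by rewrite mem_filter mem_index_iota; lia.
rewrite big_seq_cond big1 => [|t]; last first.
  rewrite mem_filter mem_index_iota => /andP[/andP[ti tn] tSi].
  by rewrite homZ /= EE nu_far ?subrr ?scaler0 //; lia.
rewrite !homZ /= !EE /d nu_top ?nu_topS; [|lia..].
by vring; field; exact: r0.
Qed.

Let qint_sum : (r + r^-1) * (r + r^-1) - 1 + \sum_(4 <= t < n.+1) r ^+ (2 * (t - 2))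
  = r ^- 2 * \sum_(j < n) (r ^+ 2) ^+ j.
Proof.
have [m ->] : exists m, n = m.+3 by exists (n - 3)%N; lia.
elim: m => [|m IH].
  by rewrite big_geq // !big_ord_recr big_ord0 /=; field; exact: r0.
rewrite big_nat_recr // addrA IH [in RHS]big_ord_recr /= mulrDr; congr (_ + _).
rewrite -exprM (_ : 2 * (m.+4 - 2) = (2 * m).+4)%N; last lia.
by rewrite (_ : 2 * m.+3 = (2 * m).+4.+2)%N; [rewrite !exprS; field; exact: r0 | lia].
Qed.

Section InvariantSubspace.
Variable X : {vspace U}.
Hypothesis iX : Defs.invariant n nu X.

Let E_mem i x : (0 < i < n)%N -> x \in X -> E i x \in X.
Proof. by move=> ? ?; rewrite EE memvB ?memvZ ?(inv_mem iX). Qed.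

Let d_down i : (2 < i)%N -> (i < n)%N -> d i \in X -> d 3 \in X.
Proof.
elim: i => [|i IH] i3 ltin dX; first discriminate i3.
have [e|i2] := eqVneq i.+1 3%N.
  by rewrite -e.
apply: IH; try lia.
rewrite -[d i](scalerK r0) memvZ //.
suff <- : nu i.+1 (nu i (d i.+1)) = r *: d i by rewrite !(inv_mem iX) //; lia.
rewrite /d !(homB, homZ) nu_topS; [|lia..].
rewrite [nu i _]nu_far; [|lia..].
rewrite !(homB, homZ) nu_topS; [|lia..].
rewrite [nu i.+1 _]nu_far; [|lia..].
rewrite nu_top; [|lia..].
by vring; field; exact: r0.
Qed.

Let d3_V13 : d 3 \in X -> V 1 3 \in X.
Proof.
move=> dX.
have eX : E 1 (E 2 (d 3)) \in X by do 2?apply: E_mem => //; lia.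
(* Indeed [E 2 (d 3) = V 1 3 + V 2 4], which [E 1] sends to [(r + r^-1) *: V 1 3 + d 3]. *)
have -> : V 1 3 = (r + r^-1)^-1 *: (E 1 (E 2 (d 3)) - d 3).
  apply: (scalerI q2); rewrite scalerA (divff q2) scale1r.
  rewrite /d (homB (E 2)) homZ E2_V13.
  rewrite E2_V1; [|lia..].
  rewrite !(homB, homZ) E1_V2; [|lia..].
  rewrite E1_V1; [|lia..].
  by vring; rewrite ?subnn ?expr0; field; exact: r0.
by apply: memvZ; apply: memvB.
Qed.

(** This combination is killed by every [E i] with [2 < i < n]. Instead, [E 1 \o E 2] adds to it
    [r ^- 2] [n] times [V 1 3]. *)
Let y0_V13 : \sum_(3 <= t < n.+1) r ^+ (t - 3) *: V 1 t \in X -> V 1 3 \in X.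
Proof.
set y := \sum_(_ <= t < _) _ => yX.
have eX : E 1 (E 2 y) \in X by do 2?apply: E_mem => //; lia.
have e : E 1 (E 2 y) - y = (r ^- 2 * \sum_(j < n) (r ^+ 2) ^+ j) *: V 1 3.
  rewrite /y big_ltn ?ltnS; last lia.
  rewrite !homD !hom_sum opprD addrACA -sumrB.
  rewrite subnn expr0 scale1r E2_V13 homZ E1_V1; try lia.
  rewrite (eq_big_nat _ _ (F2 := fun t => r ^+ (2 * (t - 2)) *: V 1 3)) => [|t tn].
    rewrite -scaler_suml scalerA -[X in _ - X + _]scale1r -scalerBl -scalerDl; congr (_ *: _).
    exact: qint_sum.
  rewrite !homZ E2_V1; [|lia..].
  rewrite homB homZ E1_V1; [|lia..].
  rewrite E1_V2; [|lia..].
  have [m tm] : exists m, t = m.+4 by exists (t - 4)%N; lia.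
  rewrite tm !subSS !subn0 (_ : 2 * m.+2 = (m + m).+4)%N; last lia.
  by vring; rewrite !exprS exprD; field; exact: r0.
have -> : V 1 3 = (r ^- 2 * \sum_(j < n) (r ^+ 2) ^+ j)^-1 *: (E 1 (E 2 y) - y).
  rewrite e scalerA mulVf ?scale1r // mulf_neq0 // invr_neq0 //.
  by rewrite expf_neq0.
by apply: memvZ; apply: memvB.
Qed.

(** If some ratio of consecutive coefficients is not [r], then some [E i] sends [y] to a nonzero
    multiple of [d i]; otherwise [y] is a multiple of the geometric combination of [y0_V13]. *)
Lemma column_sum_gen (c : nat -> F) :
  let y := \sum_(3 <= t < n.+1) c t *: V 1 t in
  y \in X -> y != 0 -> V 1 3 \in X.
Proof.
move=> y yX y0.
have [/allP ac|nac] := boolP (all (fun i => c i.+1 == r * c i) (index_iota 3 n)).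
  have cE t : (3 <= t)%N -> (t <= n)%N -> c t = r ^+ (t - 3) * c 3%N.
    elim: t => // t IH t3 tn; have [->|t2] := eqVneq t 2%N.
      by rewrite subnn mul1r.
    have /eqP-> : c t.+1 == r * c t by apply: ac; rewrite mem_index_iota; lia.
    rewrite IH; [|lia..].
    by rewrite mulrA -exprS subSn //; lia.
  have yE : y = c 3%N *: \sum_(3 <= t < n.+1) r ^+ (t - 3) *: V 1 t.
    rewrite scaler_sumr; apply: eq_big_nat => t /andP[t3 tn].
    by rewrite scalerA cE // mulrC.
  have c3 : c 3%N != 0 by apply: contraNneq y0 => c0; rewrite yE c0 scale0r.
  by apply: y0_V13; rewrite -[X in X \in _](scalerK c3) -yE memvZ.
move/allPn: nac => [ i ]; rewrite mem_index_iota => /andP[i3 ltin] ci.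
have di : c i - c i.+1 / r != 0.
  rewrite subr_eq0; apply: contra ci => /eqP->.
  by rewrite mulrCA divff // mulr1.
apply: d3_V13; apply: (@d_down i) => //.
by rewrite -[d i](scalerK di) -E_sum // memvZ // E_mem //; lia.
Qed.

End InvariantSubspace.
End ColumnVectors.

Section Irreducibility.
Variables (F : fieldType) (r : F) (n : nat).
Hypotheses (r0 : r != 0) (q2 : r + r^-1 != 0).
Hypothesis qn : \sum_(j < n) (r ^+ 2) ^+ j != 0.
Hypothesis n4 : (4 <= n)%N.

Local Notation nu := (lk_nu (- r ^+ 3) r n).
Local Notation V := (lk_vec r n).
Local Notation W := (lk_W r n).

(** [r - nu 1] kills V_k^(t) for [k > 2] and sends the cases [k = 1, 2] to combinations of V_1^(t),
    as [column_sum_gen] requires. *)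
Lemma lk_defect_W x : x \in W ->
  r *: x - nu 1 x \in <<[seq V 1 t | t <- index_iota 3 n.+1]>>%VS.
Proof.
have EE y : (r *: \1 - nu 1)%VF y = r *: y - nu 1 y.
  by rewrite add_lfunE opp_lfunE scale_lfunE id_lfunE.
move=> xW; rewrite -EE; apply: (lk_W_hom _ xW) => k t k0 kt tn; rewrite EE.
have VY s : (2 < s)%N -> (s <= n)%N ->
    V 1 s \in <<[seq V 1 t | t <- index_iota 3 n.+1]>>%VS.
  by move=> *; apply: memv_span; apply: map_f; rewrite mem_index_iota; lia.
have [k1|k1] := eqVneq k 1%N.
  by subst k; rewrite lk_nu_vec_same //; apply: memvB; rewrite memvZ // VY.
have [k2|k2] := eqVneq k 2%N; last first.
  by rewrite lk_nu_vec_far ?subrr ?mem0v //; lia.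
subst k; rewrite lk_nu_vec_down //.
rewrite -addrA opprD addNKr opprB.
by apply: memvB; rewrite ?memvZ ?VY //; lia.
Qed.

Lemma lk_W_irr : irreducible_invariant n nu W.
Proof.
split; first exact: lk_W_inv.
  move=> W0; have : lk_co F n 2 3 (V 1 3) = 0.
    have : V 1 3 \in W by apply: mem_lk_W => //; lia.
    by rewrite W0 memv0 => /eqP->; rewrite linear0.
  rewrite /lk_vec homD homB !homZ !lk_co_w; try lia.
  by rewrite /= !scaler0 subr0 addr0 => /eqP; rewrite oner_eq0.
move=> X iX XW.
have [Xk|/subvPn[x xX]] := boolP (X <= lker (r *: \1 - nu 1)%VF)%VS.
  left; apply: (lk_inv_scalar r0 q2 iX XW) => x xX.
  move/subvP/(_ x xX): Xk; rewrite memv_ker.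
  by rewrite add_lfunE opp_lfunE scale_lfunE id_lfunE subr_eq0 => /eqP->.
rewrite memv_ker add_lfunE opp_lfunE scale_lfunE id_lfunE => y0; right.
apply/eqP; rewrite eqEsubv XW /=; apply: (lk_vec13_gen r0 _ iX); first lia.
have xW := subvP XW x xX.
have [c yE] := span_mapP (iota_uniq _ _) (lk_defect_W xW).
have yX : r *: x - nu 1 x \in X.
  by apply: memvB; [apply: memvZ | apply: (inv_mem iX)] => //; lia.
rewrite yE in yX y0.
apply: (column_sum_gen r0 q2 qn n4 _ _ _ _ _ _ _ iX yX y0).
- by move=> t t2 tn; apply: lk_nu_vec_same.
- by apply: lk_nu_vec_corner => //; lia.
- by move=> t t2 tn; rewrite lk_nu_vec_up // -subnDA.
- by move=> t t2 tn; rewrite lk_nu_vec_down // -subnDA.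
- by move=> t t2 tn; apply: lk_nu_vec_top.
- by move=> t t2 tn; apply: lk_nu_vec_topS.
- by move=> i t t2 tn i2 it1 it2; apply: lk_nu_vec_far => //; lia.
Qed.

End Irreducibility.

(** * Dimension *)

Section Inclusion.
Variables (F : fieldType) (n N : nat).
Lemma lk_co_gt s t (x : lk F n) : (n < t)%N -> lk_co F n s t x = 0.
Proof.
move=> nt; transitivity ((0%VF : 'Hom(lk F n, F^o)) x); last by rewrite zero_lfunE.
apply: lk_hom_eq => a b a0 ab bn; rewrite lk_co_w // zero_lfunE.
by rewrite (_ : (b == t) = false) ?andbF //; lia.
Qed.

Hypothesis nN : (n <= N)%N.

Lemma lk_incl_w s t : (0 < s)%N -> (s < t)%N -> (t <= n)%N ->
  lk_incl F n N (lk_w F n s t) = lk_w F N s t.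
Proof. exact: lk_extE. Qed.

Lemma lk_co_incl s t x : lk_co F N s t (lk_incl F n N x) = lk_co F n s t x.
Proof.
rewrite -[LHS]comp_lfunE; apply: lk_hom_eq => a b a0 ab bn.
by rewrite comp_lfunE lk_incl_w // !lk_co_w //; apply: leq_trans nN.
Qed.

Lemma lker_lk_incl : lker (lk_incl F n N) = 0%VS.
Proof.
apply/eqP; rewrite -subv0; apply/subvP => x; rewrite memv_ker => /eqP x0.
rewrite memv0; apply/eqP; apply: lk_co_eq0 => s t *.
by rewrite -lk_co_incl x0 hom0.
Qed.

Lemma lk_incl_vec (r : F) k t : (0 < k)%N -> (k.+1 < t)%N -> (t <= n)%N ->
  lk_incl F n N (lk_vec r n k t) = lk_vec r N k t.
Proof. by move=> *; rewrite /lk_vec homD homB !homZ !lk_incl_w //; lia. Qed.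

End Inclusion.

Section LastColumn.
Variables (F : fieldType) (r : F) (n : nat).
Hypothesis r0 : r != 0.

Lemma lk_co_V k s : (0 < k)%N -> (k.+1 < n)%N ->
  lk_co F n s n (lk_V r n k) = (k.+1 == s)%:R - r * (k == s)%:R.
Proof.
move=> k0 kn; rewrite /lk_V homD homB !homZ !lk_co_w; [|lia..].
rewrite eqxx !andbT (_ : (k.+1 == n) = false); last lia.
by rewrite andbF scaler0 addr0.
Qed.

(** The coordinates in the last column form a bidiagonal system with diagonal [- r]. As these vanish
    on the image of the smaller space, directness of the sum follows as well as freeness. *)
Lemma lk_V_free (c : nat -> F) :
  (forall s, (0 < s)%N -> (s < n)%N ->
     lk_co F n s n (\sum_(k <- iota 1 (n - 2)) c k *: lk_V r n k) = 0) ->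
  forall k, (0 < k)%N -> (k.+1 < n)%N -> c k = 0.
Proof.
move=> c0 k; elim/ltn_ind: k => s IH s0 sn.
have := c0 s s0 (ltnW sn); rewrite hom_sum.
rewrite (bigD1_seq s) ?iota_uniq ?mem_iota //=; last lia.
rewrite big_seq_cond big1 => [|k]; last first.
  rewrite mem_iota => /andP[kn ks]; rewrite homZ lk_co_V; try lia.
  rewrite (negbTE ks) mulr0 subr0; case: eqP => [e|_]; last exact: scaler0.
  by rewrite IH ?scale0r //; lia.
rewrite homZ lk_co_V // eqxx (_ : (s.+1 == s) = false); last lia.
by rewrite addr0 sub0r mulr1 scale_regularE mulrN => /eqP;
  rewrite oppr_eq0 mulf_eq0 (negbTE r0) orbF => /eqP.
Qed.

Lemma free_lk_Vs : free (lk_Vs r n).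
Proof.
have sz : size (lk_Vs r n) = (n - 2)%N by rewrite size_map size_iota.
rewrite -[lk_Vs r n]/(tval (in_tuple (lk_Vs r n))); apply/freeP => c c0 i.
(* The entry at ordinal [j] is the vector of index [j.+1], whence the shift; indices beyond the
   range get 0. *)
pose c' k := if insub (k - 1)%N is Some j then c j else 0.
have c'E (j : 'I_(size (lk_Vs r n))) : c' j.+1 = c j.
  by rewrite /c' subn1 /= valK.
rewrite -c'E; apply: (@lk_V_free c'); last 2 first.
- by [].
- by have := ltn_ord i; rewrite {2}sz; lia.
move=> s _ _; rewrite (_ : \sum_(k <- _) _ = 0) ?hom0 //.
rewrite -[RHS]c0 (big_nth 0%N) size_iota -{1}sz big_mkord.
apply: eq_bigr => j _; have jn : (j < n - 2)%N by rewrite -sz.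
by rewrite (nth_map 0%N) ?size_iota // nth_iota // add1n c'E.
Qed.

End LastColumn.

Section Recursion.
Variables (F : fieldType) (r : F) (n : nat).
Lemma lk_W_rec :
  lk_W r n.+1 = (lk_incl F n n.+1 @: lk_W r n + <<lk_Vs r n.+1>>)%VS.
Proof.
apply/eqP; rewrite eqEsubv; apply/andP; split.
  apply: lk_W_sub => k t k0 kt; rewrite leq_eqVlt => /orP[/eqP e|tn].
    subst t; apply: (subvP (addvSr _ _)); apply: memv_span; apply/mapP; exists k => //.
    by rewrite mem_iota; lia.
  apply: (subvP (addvSl _ _)); rewrite -(@lk_incl_vec _ n) //.
  by apply: memv_img; apply: mem_lk_W.
rewrite subv_add; apply/andP; split.
  apply/subvP => _ /memv_imgP[x xW ->]; apply: (lk_W_hom _ xW) => k t k0 kt tn.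
  by rewrite lk_incl_vec //; apply: mem_lk_W => //; apply: leq_trans tn _.
apply/span_subvP => _ /mapP[k + ->]; rewrite mem_iota => kn.
by apply: mem_lk_W; lia.
Qed.

Hypothesis r0 : r != 0.

Lemma lk_W_rec_direct :
  directv (lk_incl F n n.+1 @: lk_W r n + <<lk_Vs r n.+1>>)%VS.
Proof.
apply/directv_addP/eqP; rewrite -subv0; apply/subvP => v /memv_capP[].
case/memv_imgP=> x _ -> xV; rewrite memv0.
have [c vE] := span_mapP (iota_uniq _ _) xV.
rewrite vE big_seq big1 // => k; rewrite mem_iota => kn.
rewrite (@lk_V_free _ r n.+1 r0 c) ?scale0r //; try lia.
by move=> s s0 sn; rewrite -vE lk_co_incl // lk_co_gt.
Qed.

End Recursion.

Lemma dim_lk_W (F : fieldType) (r : F) (n : nat) : r != 0 ->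
  (\dim (lk_W r n) * 2 = (n - 1) * (n - 2))%N.
Proof.
move=> r0; elim: n => [|n IH]; first by rewrite /lk_W span_nil dimv0.
have /directv_addP dd := lk_W_rec_direct n r0.
rewrite lk_W_rec (dimv_disjoint_sum dd).
rewrite limg_dim_eq; last by rewrite lker_lk_incl ?capv0.
rewrite mulnDl IH (eqP (free_lk_Vs n.+1 r0)) size_map size_iota.
by case: n {IH dd} => // n; nia.
Qed.

(** * Uniqueness *)

Section Uniqueness.
Variables (F : fieldType) (r : F) (n : nat).

Local Notation l := (- r ^+ 3).
Local Notation nu := (lk_nu l r n).
Local Notation w := (lk_w F n).
Local Notation W := (lk_W r n).

Lemma lk_w12_gen (X : {vspace lk F n}) :
  Defs.invariant n nu X -> w 1 2 \in X -> X = fullv.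
Proof.
move=> iX w12; apply: lk_subv => s t s0; elim: s s0 t => // -[|s] IH _ t st tn.
  elim: t st tn => // t IHt t1 tn; have [->//|t2] := eqVneq t 1%N.
  rewrite -(lk_nu_w_si r); [|lia..].
  by apply: (inv_mem iX); [lia | apply: IHt; lia].
rewrite -(lk_nu_w_ik r); [|lia..].
by apply: (inv_mem iX); [lia | apply: IH; lia].
Qed.

(** The defect of the Hecke relation for g_1. It preserves every invariant subspace, and its image
    lies in the line of [w 1 2]. *)
Definition lk_quad : 'End(lk F n) := (nu 1 \o nu 1 + lk_m r *: nu 1 - \1)%VF.

Lemma lk_quadE x : lk_quad x = nu 1 (nu 1 x) + lk_m r *: nu 1 x - x.
Proof.
by rewrite /lk_quad add_lfunE opp_lfunE add_lfunE scale_lfunE comp_lfunE id_lfunE.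
Qed.

Hypothesis r0 : r != 0.

Lemma lk_quad_w12 : (2 <= n)%N ->
  lk_quad (w 1 2) = (r ^- 6 * (1 - r ^+ 2 + r ^+ 4 - r ^+ 6)) *: w 1 2.
Proof.
move=> n2; rewrite lk_quadE !(homZ, lk_nu_w_diag); [|lia..].
rewrite !scalerA -scalerDl -[X in _ - X]scale1r -scalerBl; congr (_ *: _).
by rewrite /lk_m; field; rewrite ?oppr_eq0 ?expf_neq0 // r0.
Qed.

Lemma lk_quad_line x : lk_quad x \in <[w 1 2]>%VS.
Proof.
have quad_w s t : (0 < s)%N -> (s < t)%N -> (t <= n)%N -> lk_quad (w s t) \in <[w 1 2]>%VS.
  move=> s0 st tn; have w12 := memv_line (w 1 2).
  have [s1|s1] := eqVneq s 1%N.
    subst s; have [t2|t2] := eqVneq t 2%N.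
      by subst t; rewrite lk_quad_w12 ?memvZ.
    rewrite lk_quadE lk_nu_w_ik; [|lia..]; rewrite lk_nu_w_Sik; [|lia..].
    by rewrite subrK addrAC subrr add0r memvZ.
  have [s2|s2] := eqVneq s 2%N.
    subst s; rewrite lk_quadE [in nu 1 (nu 1 _)]lk_nu_w_Sik; [|lia..].
    rewrite homB homD !homZ lk_nu_w_ik; [|lia..].
    by rewrite lk_nu_w_diag ?subrK; [rewrite addrAC subrr add0r !memvZ | lia..].
  rewrite lk_quadE !(homZ, lk_nu_w_far); [|lia..].
  rewrite !scalerA -scalerDl -[X in _ - X]scale1r -scalerBl.
  rewrite (_ : _ - 1 = 0) ?scale0r ?mem0v // /lk_m; field; exact: r0.
have /subvP : ({:lk F n} <= lk_quad @^-1: <[w 1 2]>)%VS.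
  by rewrite (@lk_subv _ _ (lk_quad @^-1: _)) // => s t *; rewrite -memv_preim quad_w.
by move/(_ x (memvf x)); rewrite -memv_preim.
Qed.

Hypothesis q2 : r + r^-1 != 0.
Hypothesis qn : \sum_(j < n) (r ^+ 2) ^+ j != 0.
Hypothesis n4 : (4 <= n)%N.
Hypothesis q4 : n = 4%N -> 1 - r ^+ 2 + r ^+ 4 - r ^+ 6 != 0.

Lemma lk_W_main : lk_main_subspace l r W.
Proof.
split; first exact: lk_W_irr.
by rewrite -(dim_lk_W n r0) mulnK.
Qed.

Lemma lk_main_subspace_unique : unique (lk_main_subspace l r (n := n)) W.
Proof.
split=> [|X [[iX X0 Xirr] dX]]; first exact: lk_W_main.
have [[iW W0 Wirr] dW] := lk_W_main.
have iXW : Defs.invariant n nu (X :&: W)%VS.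
  move=> i lin; apply/subvP => _ /memv_imgP[x /memv_capP[xX xW] ->].
  by rewrite memv_cap (inv_mem iX) ?(inv_mem iW).
have [XW|XW] := Wirr _ iXW (capvSr _ _); last first.
  by apply/eqP; rewrite eqEdim dX dW leqnn andbT -XW capvSl.
have dXW : (\dim (X + W) * 2 = (n - 1) * (n - 2) * 2)%N.
  by rewrite (dimv_disjoint_sum XW) dX -dW addnn -muln2 -(dim_lk_W n r0).
have := dimvS (subvf (X + W)); have := dim_lk_le F n.
(* The dimension [(n-1)(n-2)] of [X + W] exceeds [n(n-1)/2] for [n > 4] and equals it for
   [n = 4]. *)
move=> le1 le2; have n4' : n = 4%N by nia.
have XWf : (X + W)%VS = fullv.
  apply/eqP; rewrite eqEdim subvf /=.
  by move: (\dim _) (\dim (X + W)) le1 dXW => a b; rewrite n4'; lia.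
have : w 1 2 \in (X + W)%VS by rewrite XWf memvf.
case/memv_addP=> x xX [y yW w12].
have quad_mem Y z : Defs.invariant n nu Y -> z \in Y -> lk_quad z \in Y.
  move=> iY zY; rewrite lk_quadE; apply: memvB => //; apply: memvD.
    by apply: (inv_mem iY); [lia | apply: (inv_mem iY) => //; lia].
  by apply: memvZ; apply: (inv_mem iY) => //; lia.
have w12_not (Y : {vspace lk F n}) a : w 1 2 \notin Y -> a *: w 1 2 \in Y -> a = 0.
  move=> wY aY; apply/eqP; apply: contraNT wY => a0.
  by rewrite -[w 1 2](scalerK a0) memvZ.
have w12W : w 1 2 \notin W.
  apply/negP => /(lk_phi_W r0) /eqP; rewrite /lk_phi lk_extE //=; last lia.
  by rewrite oppr_eq0 (negbTE q2).
have w12X : w 1 2 \notin X.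
  by apply/negP => /(lk_w12_gen iX) Xf; apply: W0; rewrite -XW Xf capfv.
(* [lk_quad x] lies both in [X] and in the line of [w 1 2], which meet in 0; likewise [lk_quad y]
   and [W]. So [lk_quad] kills [w 1 2], against [q4]. *)
have [a aE] := vlineP _ _ (lk_quad_line x).
have [b bE] := vlineP _ _ (lk_quad_line y).
have a0 : a = 0 by apply: (w12_not X _ w12X); rewrite -aE; apply: quad_mem.
have b0 : b = 0 by apply: (w12_not W _ w12W); rewrite -bE; apply: quad_mem.
have := lk_quad_w12 (leq_trans (isT : 2 <= 4)%N n4).
rewrite [in lk_quad _]w12 homD aE bE a0 b0 !scale0r addr0 => /esym/eqP.
rewrite scaler_eq0 mulf_eq0 invr_eq0 expf_eq0 (negbTE r0) (negbTE (q4 n4')) /=.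
by move=> /eqP w0; move: w12X; rewrite w0 mem0v.
Qed.

End Uniqueness.

(** * The explicit vectors u_1, u_2, u_3 for n = 4 *)

Section Four.
Variables (F : fieldType) (r : F).
Hypothesis r0 : r != 0.

Local Notation V := (lk_vec r 4).

Ltac coords4 :=
  apply/ffunP => p; rewrite /lk_u1 /lk_u2 /lk_u3 /lk_vec /= !(ffunE, scale_regularE);
  field; exact: r0.

Lemma lk_u1E : lk_u1 r 4 =
  (r^-1 + r ^- 3) *: V 2 4 + r ^- 2 *: V 1 4 - r^-1 *: V 1 3.
Proof. by coords4. Qed.

Lemma lk_u2E : lk_u2 r 4 = - r^-1 *: V 2 4 - (1 + r ^- 2) *: V 1 4 + r *: V 1 3.
Proof. by coords4. Qed.

Lemma lk_u3E : lk_u3 r 4 = V 1 4 + r^-1 *: V 1 3.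
Proof. by coords4. Qed.

Lemma lk_u_span : 1 + r ^+ 2 + r ^+ 4 + r ^+ 6 != 0 ->
  <<[:: lk_u1 r 4; lk_u2 r 4; lk_u3 r 4]>>%VS = lk_W r 4.
Proof.
move=> q4; apply/eqP; rewrite eqEsubv; apply/andP; split.
  have VW k t : (0 < k)%N -> (k.+1 < t)%N -> (t <= 4)%N -> V k t \in lk_W r 4.
    exact: mem_lk_W.
  apply/span_subvP => x; rewrite !inE => /or3P[] /eqP->.
  - by rewrite lk_u1E; apply: memvB; first apply: memvD; apply: memvZ; apply: VW.
  - by rewrite lk_u2E; apply: memvD; first apply: memvB; apply: memvZ; apply: VW.
  - by rewrite lk_u3E; apply: memvD; [|apply: memvZ]; apply: VW.
set U := <<_>>%VS.
have u1 : lk_u1 r 4 \in U by apply: memv_span; rewrite !inE eqxx.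
have u2 : lk_u2 r 4 \in U by apply: memv_span; rewrite !inE eqxx orbT.
have u3 : lk_u3 r 4 \in U by apply: memv_span; rewrite !inE eqxx !orbT.
have V13 : V 1 3 \in U.
  have c0 : r ^- 5 * (1 + r ^+ 2 + r ^+ 4 + r ^+ 6) != 0.
    by rewrite mulf_neq0 // invr_neq0 // expf_neq0.
  rewrite -[V 1 3](scalerK c0); apply: memvZ.
  (* The coefficients eliminate [V 2 4] and [V 1 4]; what is left on [V 1 3] is [r ^- 5] [4]. *)
  have -> : (r ^- 5 * (1 + r ^+ 2 + r ^+ 4 + r ^+ 6)) *: V 1 3 =
      lk_u1 r 4 + (1 + r ^- 2) *: lk_u2 r 4 + (1 + r ^- 2 + r ^- 4) *: lk_u3 r 4.
    by coords4.
  by apply: memvD; [apply: memvD|]; rewrite ?memvZ.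
have V14 : V 1 4 \in U.
  have -> : V 1 4 = lk_u3 r 4 - r^-1 *: V 1 3 by rewrite lk_u3E addrK.
  by apply: memvB; rewrite ?memvZ.
have V24 : V 2 4 \in U.
  have -> : V 2 4 = r *: (r *: V 1 3 - (1 + r ^- 2) *: V 1 4 - lk_u2 r 4).
    by coords4.
  apply: memvZ; apply: memvB; last exact: u2.
  by apply: memvB; apply: memvZ; [exact: V13 | exact: V14].
apply: lk_W_sub => k t k0 kt t4.
have : [|| (k == 1%N) && (t == 3%N), (k == 1%N) && (t == 4%N) | (k == 2%N) && (t == 4%N)].
  by lia.
by case/or3P=> /andP[/eqP-> /eqP->]; [exact: V13 | exact: V14 | exact: V24].
Qed.

End Four.

(** * The Hecke module of pairs *)

Section PairAction.
Variables (F : fieldType) (r : F).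
Hypothesis r0 : r != 0.

Definition adj_swap (j a : nat) : nat :=
  if a == j then j.+1 else if a == j.+1 then j else a.

(* A pair (a, b) stands for the word whose only nonzero letters are 1 at position
   a and 2 at position b; the letters at j and j + 1 decide how the Hecke generator
   acts. *)
Definition pair_letter (a b j : nat) : nat := (a == j) + 2 * (b == j).

(** Positions start at 0, so [pair_act j] stands for g_(j+1). Diagonal pairs are kept, as words with
    the single letter 3. *)
Definition pair_act (j : nat) (g : nat -> nat -> F) (a b : nat) : F :=
  let x := pair_letter a b j in let y := pair_letter a b j.+1 in
  if x == y then r * g a b
  else if (y < x)%N then g (adj_swap j a) (adj_swap j b)
  else g (adj_swap j a) (adj_swap j b) - lk_m r * g a b.

Ltac decide_letters :=
  rewrite /pair_act /pair_letter /adj_swap;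
  repeat first
    [ progress rewrite /= ?(eqSS, eqxx)
    | match goal with H : (?x == ?y) = false |- context [?x == ?y] => rewrite H end ].

Lemma pair_act_quad j g a b :
  pair_act j (pair_act j g) a b + lk_m r * pair_act j g a b = g a b.
Proof.
have e1 : (j == j.+1) = false by lia.
have e2 : (j.+1 == j) = false by lia.
have pos c : [|| c == j, c == j.+1 | (c != j) && (c != j.+1)] by lia.
case/or3P: (pos a) => [/eqP->|/eqP->|/andP[/negbTE a1 /negbTE a2]];
case/or3P: (pos b) => [/eqP->|/eqP->|/andP[/negbTE b1 /negbTE b2]];
  decide_letters; rewrite /lk_m; field; exact: r0.
Qed.

(** Each of [a] and [b] is [j], [j.+1], [j.+2] or elsewhere; this decides all comparisons of letters
    and leaves sixteen identities in [F]. *)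
Lemma pair_act_braid j g a b :
  pair_act j (pair_act j.+1 (pair_act j g)) a b =
  pair_act j.+1 (pair_act j (pair_act j.+1 g)) a b.
Proof.
have e1 : (j == j.+1) = false by lia.
have e2 : (j.+1 == j) = false by lia.
have e3 : (j == j.+2) = false by lia.
have e4 : (j.+2 == j) = false by lia.
have pos c : [|| c == j, c == j.+1, c == j.+2 | [&& c != j, c != j.+1 & c != j.+2]] by lia.
case/or4P: (pos a) => [/eqP->|/eqP->|/eqP->|/and3P[/negbTE a1 /negbTE a2 /negbTE a3]];
case/or4P: (pos b) => [/eqP->|/eqP->|/eqP->|/and3P[/negbTE b1 /negbTE b2 /negbTE b3]];
  decide_letters; rewrite /lk_m; field; by rewrite ?r0.
Qed.

Lemma pair_act_comm j k g a b : (j.+1 < k)%N ->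
  pair_act j (pair_act k g) a b = pair_act k (pair_act j g) a b.
Proof.
move=> jk.
have e1 : (j == j.+1) = false by lia.
have e2 : (j.+1 == j) = false by lia.
have e3 : (k == k.+1) = false by lia.
have e4 : (k.+1 == k) = false by lia.
have e5 : (j == k) = false by lia.
have e6 : (k == j) = false by lia.
have e7 : (j == k.+1) = false by lia.
have e8 : (k.+1 == j) = false by lia.
have e9 : (j.+1 == k) = false by lia.
have e0 : (k == j.+1) = false by lia.
have pos c : [|| c == j, c == j.+1, c == k | (c == k.+1) ||
    [&& c != j, c != j.+1, c != k & c != k.+1]] by lia.
case/or4P: (pos a) => [/eqP->|/eqP->|/eqP->|
  /orP[/eqP->|/and4P[/negbTE a1 /negbTE a2 /negbTE a3 /negbTE a4]]];
case/or4P: (pos b) => [/eqP->|/eqP->|/eqP->|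
  /orP[/eqP->|/and4P[/negbTE b1 /negbTE b2 /negbTE b3 /negbTE b4]]];
  decide_letters; ring.
Qed.

(* The q-symmetric vector: r to the number of inversions of the word, up to a
   constant. *)
Definition pair_sym (a b : nat) : F :=
  if a == b then 0 else r ^+ (a + b - (b < a)%N).

Lemma pair_sym_act j a b : pair_act j pair_sym a b = r * pair_sym a b.
Proof.
have e1 : (j == j.+1) = false by lia.
have e2 : (j.+1 == j) = false by lia.
have pos c : [|| c == j, c == j.+1 | (c != j) && (c != j.+1)] by lia.
have powS x y : x = y.+1 -> r ^+ x = r * r ^+ y by move->; rewrite exprS.
have powV x y : x = y.+1 -> r ^+ y - lk_m r * r ^+ x = r * r ^+ x.
  by move->; rewrite /lk_m exprS; field; exact: r0.
case/or3P: (pos a) => [/eqP->|/eqP->|/andP[/negbTE a1 /negbTE a2]];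
case/or3P: (pos b) => [/eqP->|/eqP->|/andP[/negbTE b1 /negbTE b2]];
  decide_letters; rewrite /pair_sym ?[_ == b]eq_sym; decide_letters;
  first [by rewrite ?mulr0 ?subr0 | apply: powS; lia | apply: powV; lia].
Qed.

End PairAction.

Section PairModule.
Variables (F : fieldType) (r : F) (n : nat).

Lemma adj_swapK j : involutive (adj_swap j).
Proof.
move=> a; rewrite /adj_swap; case: (a =P j) => [->|aj].
  by rewrite eqxx; case: eqP => ?; lia.
by case: (a =P j.+1) => [->|aj']; rewrite ?eqxx //; do 2?case: eqP => ?; lia.
Qed.

Lemma adj_swap_eq j a b : (adj_swap j a == b) = (a == adj_swap j b).
Proof. by rewrite -{1}[b](adj_swapK j) (inj_eq (can_inj (adj_swapK j))). Qed.

Lemma adj_swap_lt j a : (j.+1 < n)%N -> (adj_swap j a < n)%N = (a < n)%N.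
Proof. by rewrite /adj_swap; do 2?case: eqP => ?; lia. Qed.

Lemma adj_swapl j : adj_swap j j = j.+1.
Proof. by rewrite /adj_swap eqxx. Qed.

Lemma adj_swapr j : adj_swap j j.+1 = j.
Proof. by rewrite -{1}(adj_swapl j) adj_swapK. Qed.

Lemma pair_letter_swap j a b :
  (pair_letter (adj_swap j a) (adj_swap j b) j = pair_letter a b j.+1) *
  (pair_letter (adj_swap j a) (adj_swap j b) j.+1 = pair_letter a b j).
Proof. by split; rewrite /pair_letter !adj_swap_eq ?adj_swapl ?adj_swapr. Qed.

Definition pairs : vectType F := {ffun 'I_n * 'I_n -> F^o}.

Definition pair_fun (f : pairs) (a b : nat) : F :=
  if insub a is Some a' then if insub b is Some b' then f (a', b') else 0 else 0.

Definition pairs_of (g : nat -> nat -> F) : pairs :=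
  [ffun p : 'I_n * 'I_n => g p.1 p.2 : F^o].

Lemma pair_funE f (p : 'I_n * 'I_n) : pair_fun f p.1 p.2 = f p.
Proof. by case: p => a b; rewrite /pair_fun !valK. Qed.

Lemma pair_fun_of g a b : pair_fun (pairs_of g) a b = g a b *+ ((a < n) && (b < n))%N.
Proof.
rewrite /pair_fun; case: insubP => [a' -> <-|/negbTE->] //=.
by case: insubP => [b' -> <-|/negbTE->] //=; rewrite ffunE.
Qed.

Lemma pair_fun_out f a b : ~~ ((a < n) && (b < n))%N -> pair_fun f a b = 0.
Proof.
by rewrite /pair_fun; case: insubP => [a' -> _|] //=; case: insubP => [b' -> _|].
Qed.

Lemma pairs_ext (f h : pairs) : (forall a b, pair_fun f a b = pair_fun h a b) -> f = h.
Proof. by move=> fh; apply/ffunP => p; rewrite -!pair_funE fh. Qed.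

Lemma pair_funP c (f h : pairs) a b :
  pair_fun (c *: f + h) a b = c * pair_fun f a b + pair_fun h a b.
Proof.
rewrite /pair_fun; case: insubP => [a' _ _|_]; last by rewrite mulr0 addr0.
by case: insubP => [b' _ _|_]; rewrite ?mulr0 ?addr0 // !ffunE.
Qed.

Definition pair_gen (i : nat) : 'End(pairs) :=
  linfun (fun f : {ffun 'I_n * 'I_n -> F^o} => pairs_of (pair_act r i.-1 (pair_fun f))).

Lemma pair_genE i f : pair_gen i f = pairs_of (pair_act r i.-1 (pair_fun f)).
Proof.
pose h (f : pairs) := pairs_of (pair_act r i.-1 (pair_fun f)).
have hlin : linear h.
  move=> c u v; apply/ffunP => p; rewrite !ffunE /pair_act !pair_funP.
  case: ifP => _; first by rewrite scale_regularE; ring.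
  by case: ifP => _ //; rewrite scale_regularE; ring.
pose H : {linear pairs -> pairs} := HB.pack h (GRing.isLinear.Build _ _ _ _ h hlin).
exact: (lfunE H).
Qed.

(** The swap preserves the range below [n], so extension by 0 commutes with the action, and the
    relations of [pair_act] pass to [pair_gen]. *)
Lemma pair_fun_gen i f : (0 < i < n)%N ->
  pair_fun (pair_gen i f) = pair_act r i.-1 (pair_fun f).
Proof.
move=> lin; apply: boolp.funext => a; apply: boolp.funext => b; rewrite pair_genE pair_fun_of.
case: (boolP ((a < n) && (b < n))%N) => [//|abn]; rewrite /= mulr0n.
have iSn : (i.-1.+1 < n)%N by lia.
by rewrite /pair_act !pair_fun_out ?adj_swap_lt // !mulr0 subr0 !if_same.
Qed.

Hypothesis r0 : r != 0.

Lemma pair_hecke : hecke_module r n pair_gen.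
Proof.
split=> [i lin|i i0 iSn|i j i0 ij jn]; apply/lfunP => f; apply: pairs_ext => a b.
- rewrite add_lfunE scale_lfunE comp_lfunE id_lfunE addrC pair_funP.
  by rewrite !pair_fun_gen // addrC pair_act_quad.
- rewrite !comp_lfunE !pair_fun_gen; try lia.
  by case: i i0 {iSn} => // i _; rewrite pair_act_braid.
- rewrite !comp_lfunE !pair_fun_gen; try lia.
  by rewrite pair_act_comm //; lia.
Qed.

Lemma pair_gen_sym i : (0 < i < n)%N ->
  pair_gen i (pairs_of (pair_sym r)) = r *: pairs_of (pair_sym r).
Proof.
move=> lin; apply/ffunP => p; rewrite -[LHS]pair_funE pair_fun_gen // !ffunE.
rewrite scale_regularE -(pair_sym_act r0 i.-1).
rewrite /pair_act !pair_fun_of /= !ltn_ord /= mulr1n.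
by rewrite !adj_swap_lt ?ltn_ord //; lia.
Qed.

Definition pair_delta (a b : nat) : pairs :=
  pairs_of (fun a' b' => ((a' == a) && (b' == b))%:R).

Lemma pair_decomp (f : pairs) :
  f = \sum_(p : 'I_n * 'I_n) (f p : F) *: pair_delta p.1 p.2.
Proof.
apply/ffunP => q; rewrite sum_ffunE (bigD1 q) //= !ffunE !eqxx scale_regularE mulr1.
rewrite big1 ?addr0 // => p; rewrite -pair_eqE /= /pair_eq !ffunE => neq.
by rewrite [val q.1 == _]eq_sym [val q.2 == _]eq_sym !val_eqE (negbTE neq) scaler0.
Qed.

(** A descent becomes an ascent without a term in [m], so an equivariant functional changes exactly
    by the factor [r]. *)
Lemma pair_gen_delta j a b : (j.+1 < n)%N ->
  (pair_letter a b j.+1 < pair_letter a b j)%N ->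
  pair_gen j.+1 (pair_delta a b) = pair_delta (adj_swap j a) (adj_swap j b).
Proof.
move=> jn lt_ab; apply/ffunP => p; rewrite -[LHS]pair_funE pair_fun_gen // !ffunE /=.
rewrite /pair_act !pair_fun_of !adj_swap_lt // !ltn_ord !mulr1n !adj_swap_eq.
move: (nat_of_ord p.1) (nat_of_ord p.2) => c d.
have [/andP[/eqP-> /eqP->]|ncd] := boolP ((c == a) && (d == b)).
  by rewrite lt_ab; case: eqP => // e; rewrite e ltnn in lt_ab.
rewrite !mulr0 subr0 if_same; case: eqP => // e.
have [/andP[/eqP ca /eqP db]|//] := boolP ((c == _) && _).
by move: e lt_ab; rewrite ca db !pair_letter_swap => ->; rewrite ltnn.
Qed.

(** Semisimplicity enters here: [P] is the projection onto the line of [v] along an invariant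
    complement. *)
Lemma equivariant_functional (E : vectType F) (g : nat -> 'End(E)) (v : E) :
  hecke_semisimple r n -> hecke_module r n g -> v != 0 ->
  (forall i, (0 < i < n)%N -> g i v = r *: v) ->
  exists P : 'End(E), [/\ P v = v, forall x, P x \in <[v]>%VS &
    forall i x, (0 < i < n)%N -> P (g i x) = r *: P x].
Proof.
move=> ss hg v0 gv; have iU : Defs.invariant n g <[v]>.
  move=> i lin; apply/subvP => _ /memv_imgP[_ /vlineP[a ->] ->].
  by rewrite linearZ /= gv // !memvZ ?memv_line.
have [U' [iU' UU' UI]] := ss E g hg _ iU.
have UI' : (U' :&: <[v]> = 0)%VS by rewrite capvC.
exists (daddv_pi <[v]> U'); split=> [|x|i x lin].
- by rewrite daddv_pi_id ?memv_line.
- exact: memv_pi.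
set P := daddv_pi _ _.
have PU' z : z \in U' -> P z = 0.
  move=> zU'; apply: (addIr z); rewrite add0r -[RHS](daddv_pi_add UI) ?UU' ?memvf //.
  by rewrite (daddv_pi_id UI').
have xE : x = P x + daddv_pi U' <[v]> x by rewrite daddv_pi_add ?UU' ?memvf.
rewrite {1}xE !linearD /= [X in _ + X]PU' ?addr0; last first.
  by apply: (inv_mem iU') => //; apply: memv_pi.
have /vlineP[a ->] : P x \in <[v]>%VS by apply: memv_pi.
rewrite linearZ /= gv // !linearZ /=; congr (_ *: _).
by rewrite /P daddv_pi_id ?memv_line.
Qed.

(** The pair (1, 0) is the word 2 1 0 0 ... . Every off-diagonal pair is reached from it by moves
    from a descent to an ascent: [a] moves right, [b] follows, then passes [a] if required. The
    exponent in [pair_sym] counts these moves. *)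
Lemma pair_weight (C : nat -> nat -> F) :
  (forall j a b, (j.+1 < n)%N ->
     (pair_letter a b j.+1 < pair_letter a b j)%N ->
     C (adj_swap j a) (adj_swap j b) = r * C a b) ->
  forall a b, (a < n)%N -> (b < n)%N -> C a b *+ (a != b) = pair_sym r a b * C 1%N 0%N.
Proof.
move=> CE.
have neq_swap j c : c != j -> c != j.+1 -> adj_swap j c = c.
  by move=> /negbTE cj /negbTE cj'; rewrite /adj_swap cj cj'.
have stepA j b : (j.+1 < n)%N -> b != j -> b != j.+1 -> C j.+1 b = r * C j b.
  move=> jn bj bj'; have := CE j j b jn; rewrite adj_swapl neq_swap // => -> //.
  by rewrite /pair_letter; lia.
have stepB j a : (j.+1 < n)%N -> a != j -> a != j.+1 -> C a j.+1 = r * C a j.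
  move=> jn aj aj'; have := CE j a j jn; rewrite adj_swapl neq_swap // => -> //.
  by rewrite /pair_letter; lia.
have stepC j : (j.+1 < n)%N -> C j j.+1 = r * C j.+1 j.
  move=> jn; have := CE j j.+1 j jn; rewrite adj_swapl adj_swapr => -> //.
  by rewrite /pair_letter; lia.
have C1 a : (a.+1 < n)%N -> C a.+1 0%N = r ^+ a * C 1%N 0%N.
  elim: a => [|a IH] an; first by rewrite mul1r.
  by rewrite stepA // IH ?mulrA -?exprS //; lia.
have C2 b a : (b < a)%N -> (a < n)%N -> C a b = r ^+ (a + b - 1) * C 1%N 0%N.
  elim: b a => [|b IH] a ba an.
    by case: a ba an => // a _ an; rewrite C1 // addn0 subn1.
  rewrite stepB; [|lia..]; rewrite IH; [|lia..].
  by rewrite mulrA -exprS; congr (_ ^+ _ * _); lia.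
have C3 b a : (a < b)%N -> (b < n)%N -> C a b = r ^+ (a + b) * C 1%N 0%N.
  elim: b a => // b IH a ab bn; have [e|nab] := eqVneq a b.
    subst a; rewrite stepC // C2 //.
    by rewrite mulrA -exprS; congr (_ ^+ _ * _); lia.
  rewrite stepB; [|lia..]; rewrite IH; [|lia..].
  by rewrite mulrA -exprS addnS.
move=> a b an bn; rewrite /pair_sym; case: (ltngtP b a) => [ba|ab|->].
- by rewrite /= C2.
- by rewrite /= C3 // subn0.
- by rewrite mul0r.
Qed.

(** At the pair (1, 0), where [v] is 1, the equation [P v = v] expands by [pair_weight] to: 1 is the
    sum times [C 1 0]. *)
Lemma pair_sum_neq0 : hecke_semisimple r n -> (1 < n)%N ->
  \sum_(p : 'I_n * 'I_n) pair_sym r p.1 p.2 ^+ 2 != 0.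
Proof.
move=> ss n1; set v := pairs_of (pair_sym r).
have v10 : pair_fun v 1 0 = 1 by rewrite pair_fun_of n1 (ltnW n1) /pair_sym /=.
have pair_fun0 a b : pair_fun 0 a b = 0.
  by rewrite /pair_fun; case: insubP => // ? _ _; case: insubP => // ? _ _; rewrite ffunE.
have v0 : v != 0.
  by apply: contra_eq_neq v10 => ->; rewrite pair_fun0 eq_sym oner_eq0.
have [P [Pv PU PE]] := equivariant_functional ss pair_hecke v0 pair_gen_sym.
pose C a b := pair_fun (P (pair_delta a b)) 1 0.
have CE j a b : (j.+1 < n)%N -> (pair_letter a b j.+1 < pair_letter a b j)%N ->
    C (adj_swap j a) (adj_swap j b) = r * C a b.
  move=> jn lt_ab; rewrite /C -pair_gen_delta // PE //.
  by rewrite -[_ *: _]addr0 pair_funP pair_fun0 addr0.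
have /(congr1 (fun f => pair_fun f 1 0)) := Pv; rewrite v10 (pair_decomp v).
rewrite linear_sum /=.
have -> (I : finType) (G : I -> pairs) :
    pair_fun (\sum_(i : I) G i) 1 0 = \sum_(i : I) pair_fun (G i) 1 0.
  apply: (big_morph (fun f => pair_fun f 1 0)) => [f h|]; last exact: pair_fun0.
  by rewrite -[f]scale1r pair_funP mul1r scale1r.
move=> sum1; suff sumC : \sum_(p : 'I_n * 'I_n) pair_sym r p.1 p.2 ^+ 2 * C 1%N 0%N = 1.
  by apply: contra_eq_neq sumC => sum0; rewrite -mulr_suml sum0 mul0r eq_sym oner_neq0.
rewrite -[RHS]sum1; apply: eq_bigr => p _.
rewrite linearZ /= -[_ *: _]addr0 pair_funP pair_fun0 addr0 ffunE -/(C _ _).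
rewrite expr2 -mulrA -(pair_weight CE) ?ltn_ord // /pair_sym.
by case: eqP => _; rewrite ?mul0r.
Qed.

(** For fixed [b], the other positions are [a = bump b j], with [a - (b < a) = j]. The exponent is
    thus [b + j], and the double sum factors. *)
Lemma pair_sum : (0 < n)%N -> \sum_(p : 'I_n * 'I_n) pair_sym r p.1 p.2 ^+ 2 =
  (\sum_(j < n) (r ^+ 2) ^+ j) * (\sum_(j < n.-1) (r ^+ 2) ^+ j).
Proof.
case: n => // N _; rewrite /=.
rewrite -(pair_big xpredT xpredT (fun a b : 'I_N.+1 => pair_sym r a b ^+ 2)) /=.
rewrite exchange_big /= mulr_suml; apply: eq_bigr => b _.
rewrite (bigD1_ord b) //= /pair_sym eqxx expr0n add0r mulr_sumr.
apply: eq_bigr => j _; rewrite /= (negbTE (_ : bump b j != b)); last by rewrite eq_sym neq_bump.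
rewrite -exprD exprAC; congr (_ ^+ _).
by rewrite /bump; case: leqP => ?; lia.
Qed.

End PairModule.

(** * Nonvanishing of [2], [n], [n-1], and the two cases of the claim *)

Section QuantumIntegers.
Variables (F : fieldType) (r : F).
Hypotheses (r0 : r != 0) (r2 : r ^+ 2 != 1).

(** [n][n-1] is nonzero by [pair_sum_neq0]. If [2] were 0, then [r ^+ 2 = - 1], and the even one
    among [n] and [n - 1] would make the product vanish. The bound on [n-1] serves the subspace of
    V^(n-1). *)
Lemma hecke_semisimple_q n : hecke_semisimple r n -> (1 < n)%N ->
  [/\ r + r^-1 != 0, \sum_(j < n) (r ^+ 2) ^+ j != 0
    & \sum_(j < n.-1) (r ^+ 2) ^+ j != 0].
Proof.
move=> ss n1; have := pair_sum_neq0 r0 ss n1; rewrite (pair_sum r0); last lia.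
rewrite mulf_eq0 negb_or => /andP[qn qn1]; split=> //.
apply: contra_neq (mulf_neq0 qn qn1) => q2.
have alt m : \sum_(j < m) (r ^+ 2) ^+ j = (odd m)%:R.
  have -> : r ^+ 2 = - 1.
    by apply: (mulIf (invr_neq0 r0)); rewrite expr2 mulfK // mulN1r; apply/eqP;
      rewrite -addr_eq0 q2.
  elim: m => [|m IH]; first by rewrite big_ord0.
  by rewrite big_ord_recr IH /= -signr_odd; case: odd; rewrite ?expr1 ?subrr ?add0r.
rewrite !alt; case: n n1 {ss qn qn1} => //= m _.
by case: odd; rewrite ?mul0r ?mulr0.
Qed.

Lemma lk_main_unique n : (4 <= n)%N -> r + r^-1 != 0 ->
  \sum_(j < n) (r ^+ 2) ^+ j != 0 ->
  unique (lk_main_subspace (- r ^+ 3) r (n := n)) (lk_W r n).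
Proof.
move=> n4 q2 qn; apply: lk_main_subspace_unique => // n4'.
move: qn; rewrite n4' !big_ord_recr big_ord0 /= => qn.
(* The factor [1 + r ^+ 4] divides [4], which equals [(1 + r ^+ 2) * (1 + r ^+ 4)]. *)
have -> : 1 - r ^+ 2 + r ^+ 4 - r ^+ 6 = (1 - r ^+ 2) * (1 + r ^+ 4) by ring.
rewrite mulf_neq0 //; first by rewrite subr_eq0 eq_sym.
apply: contra_neq qn => q4.
by rewrite [LHS](_ : _ = (1 + r ^+ 2) * (1 + r ^+ 4)); [rewrite q4 mulr0 | ring].
Qed.

Lemma lk_main_decomposition n : (5 <= n)%N -> hecke_semisimple r n ->
  exists W' : {vspace lk F (n - 1)},
    [/\ unique (lk_main_subspace (- r ^+ 3) r (n := n - 1)) W',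
        free (lk_Vs r n),
        directv (lk_incl F (n - 1) n @: W' + <<lk_Vs r n>>)%VS
      & unique (lk_main_subspace (- r ^+ 3) r (n := n))
          (lk_incl F (n - 1) n @: W' + <<lk_Vs r n>>)%VS].
Proof.
case: n => // n n4 ss; have [q2 qn qn1] := hecke_semisimple_q ss (ltnW (ltnW (ltnW n4))).
(* Now [n] stands for the former [n - 1]: [qn1] is the condition for the smaller space, [qn] for the
   larger. *)
rewrite subSS subn0; exists (lk_W r n); split.
- exact: lk_main_unique.
- exact: free_lk_Vs.
- exact: lk_W_rec_direct.
- by rewrite -lk_W_rec; apply: lk_main_unique => //; apply: leqW.
Qed.

Lemma lk_main_four : hecke_semisimple r 4 ->
  unique (lk_main_subspace (- r ^+ 3) r (n := 4))
    <<[:: lk_u1 r 4; lk_u2 r 4; lk_u3 r 4]>>%VS.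
Proof.
move=> ss; have [q2 q4 _] := hecke_semisimple_q ss isT.
rewrite lk_u_span //; first exact: lk_main_unique.
by apply: contra_neq q4 => q4; rewrite -[RHS]q4 !big_ord_recr big_ord0 /=; ring.
Qed.

End QuantumIntegers.

(* The field of complex numbers is R[i] = complex R, for R : realType.
   "unique P W" (Corelib) says that W is the one and only object satisfying P. *)
Theorem theorem8 (R : realType) (l r : complex R) (n : nat)
    (hl : l != 0) (hr : r != 0) (hr2 : r ^+ 2 != 1) (hn : (4 <= n)%N)
    (hss : hecke_semisimple (genF2 l r) n)
    (hlr : l = - r ^+ 3) :
  (n = 4%N ->
     unique (lk_main_subspace (genF1 l r) (genF2 l r) (n := 4))
       <<[:: lk_u1 (genF2 l r) 4; lk_u2 (genF2 l r) 4; lk_u3 (genF2 l r) 4]>>%VS)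
  /\
  ((5 <= n)%N ->
     exists W' : {vspace lk (genF l r) (n - 1)},
       [/\ unique (lk_main_subspace (genF1 l r) (genF2 l r) (n := n - 1)) W',
           free (lk_Vs (genF2 l r) n),
           directv (lk_incl (genF l r) (n - 1) n @: W' + <<lk_Vs (genF2 l r) n>>)%VS
         & unique (lk_main_subspace (genF1 l r) (genF2 l r) (n := n))
             (lk_incl (genF l r) (n - 1) n @: W' + <<lk_Vs (genF2 l r) n>>)%VS]).
Proof.
set r' := genF2 l r.
(* The inclusion of [genF l r] in the complex numbers is injective, so the conditions on [r] and the
   equation for [l] hold in the subfield. *)
have r'0 : r' != 0 by rewrite -(inj_eq val_inj).
have r'2 : r' ^+ 2 != 1 by rewrite -(inj_eq val_inj).
have -> : genF1 l r = - r' ^+ 3 by apply: val_inj.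
split=> [n4|n5]; last exact: lk_main_decomposition.
by rewrite n4 in hss; apply: lk_main_four.
Qed.
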